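(* A degenerate $3$-$(\alpha,\delta)$-Sasaki manifold $M$ (i.e. one with $\delta=0$) fibers locally over a hyperkähler manifold; that is, the base $N$ of its (locally defined) canonical submersion $\pi\colon M\to N$ is hyperkähler.
   Context: An almost contact metric structure $(\varphi,\xi,\eta,g)$ on an odd-dimensional manifold consists of a $(1,1)$-tensor field $\varphi$, a vector field $\xi$, a $1$-form $\eta$ and a Riemannian metric $g$ with $\varphi^2=-I+\eta\otimes\xi$, $\eta(\xi)=1$, $\varphi\xi=0$, $\eta\circ\varphi=0$, $g(\varphi X,\varphi Y)=g(X,Y)-\eta(X)\eta(Y)$. An almost $3$-contact metric manifold $(M,\varphi_i,\xi_i,\eta_i,g)$ is a manifold of dimension $4n+3$ with three almost contact metric structures $(\varphi_i,\xi_i,\eta_i,g)$, $i=1,2,3$, sharing the metric $g$, such that for every even permutation $(ijk)$ of $(123)$: $\varphi_k=\varphi_i\varphi_j-\eta_j\otimes\xi_i=-\varphi_j\varphi_i+\eta_i\otimes\xi_j$, $\xi_k=\varphi_i\xi_j=-\varphi_j\xi_i$, $\eta_k=\eta_i\circ\varphi_j=-\eta_j\circ\varphi_i$. Put $\mathcal V=\langle\xi_1,\xi_2,\xi_3\rangle$ and $\Phi_i(X,Y)=g(X,\varphi_iY)$. It is a $3$-$(\alpha,\delta)$-Sasaki manifold, with real constants $\alpha\neq0$ and $\delta$, if $d\eta_i=2\alpha\Phi_i+2(\alpha-\delta)\eta_j\wedge\eta_k$ for every even permutation $(ijk)$ of $(123)$. Conventions: $d\eta(X,Y)=X(\eta(Y))-Y(\eta(X))-\eta([X,Y])$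 and $(\eta\wedge\eta')(X,Y)=\eta(X)\eta'(Y)-\eta(Y)\eta'(X)$. The canonical submersion of $M$ is the locally defined Riemannian submersion $\pi\colon M\to N$ onto a Riemannian manifold $(N,g_N)$ whose vertical distribution $\ker\pi_*$ is $\mathcal V$ (here $M$ stands for a sufficiently small open subset on which $\pi$ is defined and admits a section). *)

(* Defs.v *)
From mathcomp Require Import all_boot all_order all_algebra perm.
From mathcomp Require Import all_classical all_reals all_analysis.

Set Implicit Arguments.
Unset Strict Implicit.
Unset Printing Implicit Defensive.

Import Order.TTheory GRing.Theory Num.Theory.
Import numFieldNormedType.Exports.

Local Open Scope classical_set_scope.
Local Open Scope ring_scope.

(* Meant for U open: f is then C^(k+1) iff it is differentiable on U and all
   its directional derivatives are C^k. *)
Fixpoint Ck (R : realType) (m : nat) (W : normedModType R) (k : nat)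
    (U : set 'rV[R]_m) (f : 'rV[R]_m -> W) : Prop :=
  match k with
  | 0%N => forall x, U x -> {for x, continuous f}
  | k'.+1 => (forall x, U x -> differentiable f x) /\
             (forall v, Ck k' U (fun x => 'D_v f x))
  end.

Definition smooth (R : realType) (m : nat) (W : normedModType R)
    (U : set 'rV[R]_m) (f : 'rV[R]_m -> W) : Prop :=
  forall k, Ck k U f.

(* The map [coord c] is meaningful on [cdom c] only, and its inverse [param c]
   on the open set [coord c @` cdom c] only. *)
Record manifold (R : realType) (m : nat) := Manifold {
  space :> topologicalType;
  space_hausdorff : hausdorff_space space;
  space_second_countable : @second_countable space;
  atlas : Type;
  cdom : atlas -> set space;
  coord : atlas -> space -> 'rV[R]_m;
  param : atlas -> 'rV[R]_m -> space;
  cdom_open : forall c, open (cdom c);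
  cdom_cover : forall p, exists c, cdom c p;
  coordK : forall c p, cdom c p -> param c (coord c p) = p;
  cimg_open : forall c, open (coord c @` cdom c);
  coord_continuous : forall c p, cdom c p -> {for p, continuous (coord c)};
  param_continuous : forall c x, (coord c @` cdom c) x ->
    {for x, continuous (param c)};
  transition_smooth : forall c c',
    smooth (coord c @` (cdom c `&` cdom c')) (coord c' \o param c)
}.

Definition cimg (R : realType) (m : nat) (M : manifold R m) (c : atlas M) :
    set 'rV[R]_m := coord c @` cdom c.

(* Coordinate change of a tangent vector at p, from the chart c to c'. *)
Definition dtrans (R : realType) (m : nat) (M : manifold R m)
    (c c' : atlas M) (p : M) (v : 'rV[R]_m) : 'rV[R]_m :=
  'd (coord c' \o param c) (coord c p) v.

(* A tensor field is a family of fields on the chart images, smooth, and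
   related by the differentials of the coordinate changes. *)

Record vector_field (R : realType) (m : nat) (M : manifold R m) := VectorField {
  vf :> atlas M -> 'rV[R]_m -> 'rV[R]_m;
  vf_smooth : forall c, smooth (cimg c) (vf c);
  vf_trans : forall c c' p, cdom c p -> cdom c' p ->
    vf c' (coord c' p) = dtrans c c' p (vf c (coord c p))
}.

Record one_form (R : realType) (m : nat) (M : manifold R m) := OneForm {
  of1 :> atlas M -> 'rV[R]_m -> 'rV[R]_m -> R;
  of1_linear : forall c x, cimg c x -> scalar (of1 c x);
  of1_smooth : forall c v, smooth (cimg c) (fun x => of1 c x v);
  of1_trans : forall c c' p v, cdom c p -> cdom c' p ->
    of1 c' (coord c' p) (dtrans c c' p v) = of1 c (coord c p) v
}.

Record endo_field (R : realType) (m : nat) (M : manifold R m) := EndoField {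
  ef :> atlas M -> 'rV[R]_m -> 'rV[R]_m -> 'rV[R]_m;
  ef_linear : forall c x, cimg c x -> linear (ef c x);
  ef_smooth : forall c v, smooth (cimg c) (fun x => ef c x v);
  ef_trans : forall c c' p v, cdom c p -> cdom c' p ->
    ef c' (coord c' p) (dtrans c c' p v) = dtrans c c' p (ef c (coord c p) v)
}.

Record riemannian_metric (R : realType) (m : nat) (M : manifold R m) :=
  RiemannianMetric {
  rm :> atlas M -> 'rV[R]_m -> 'rV[R]_m -> 'rV[R]_m -> R;
  rm_linear : forall c x u, cimg c x -> scalar (rm c x u);
  rm_sym : forall c x u v, cimg c x -> rm c x u v = rm c x v u;
  rm_pos : forall c x v, cimg c x -> v != 0 -> 0 < rm c x v v;
  rm_smooth : forall c u v, smooth (cimg c) (fun x => rm c x u v);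
  rm_trans : forall c c' p u v, cdom c p -> cdom c' p ->
    rm c' (coord c' p) (dtrans c c' p u) (dtrans c c' p v) =
    rm c (coord c p) u v
}.

Definition lie_bracket (R : realType) (m : nat) (X Y : 'rV[R]_m -> 'rV[R]_m)
    (x : 'rV[R]_m) : 'rV[R]_m :=
  'D_(X x) Y x - 'D_(Y x) X x.

Definition ext_deriv (R : realType) (m : nat)
    (eta : 'rV[R]_m -> 'rV[R]_m -> R) (X Y : 'rV[R]_m -> 'rV[R]_m)
    (x : 'rV[R]_m) : R :=
  'D_(X x) (fun y => eta y (Y y)) x - 'D_(Y x) (fun y => eta y (X y)) x
  - eta x (lie_bracket X Y x).

Definition wedge (R : realType) (m : nat) (a b : 'rV[R]_m -> R)
    (u v : 'rV[R]_m) : R :=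
  a u * b v - a v * b u.

Definition almost_contact_metric (R : realType) (m : nat) (M : manifold R m)
    (phi : endo_field M) (xi : vector_field M) (eta : one_form M)
    (g : riemannian_metric M) : Prop :=
  forall (c : atlas M) (x : 'rV[R]_m), cimg c x ->
  [/\ forall v, phi c x (phi c x v) = - v + eta c x v *: xi c x,
      eta c x (xi c x) = 1,
      phi c x (xi c x) = 0,
      forall v, eta c x (phi c x v) = 0
    & forall u v,
        g c x (phi c x u) (phi c x v) = g c x u v - eta c x u * eta c x v].

(* The indices 1, 2, 3 are the elements 0, 1, 2 of 'I_3. *)
Definition for_even_perm (P : 'I_3 -> 'I_3 -> 'I_3 -> Prop) : Prop :=
  forall s : 'S_3, ~~ odd_perm s -> P (s 0) (s 1) (s 2).

Definition almost_3_contact_metric (R : realType) (n : nat)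
    (M : manifold R (4 * n + 3)) (phi : 'I_3 -> endo_field M)
    (xi : 'I_3 -> vector_field M) (eta : 'I_3 -> one_form M)
    (g : riemannian_metric M) : Prop :=
  (forall i, almost_contact_metric (phi i) (xi i) (eta i) g) /\
  for_even_perm (fun i j k =>
    forall (c : atlas M) (x : 'rV[R]_(4 * n + 3)), cimg c x ->
    [/\ forall v, phi k c x v =
          phi i c x (phi j c x v) - eta j c x v *: xi i c x,
        forall v, phi k c x v =
          - phi j c x (phi i c x v) + eta i c x v *: xi j c x,
        xi k c x = phi i c x (xi j c x) /\ xi k c x = - phi j c x (xi i c x),
        forall v, eta k c x v = eta i c x (phi j c x v)
      & forall v, eta k c x v = - eta j c x (phi i c x v)]).

Definition fundamental_form (R : realType) (m : nat) (M : manifold R m)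
    (g : riemannian_metric M) (phi : endo_field M) (c : atlas M)
    (x u v : 'rV[R]_m) : R :=
  g c x u (phi c x v).

Definition sasaki_3_alpha_delta (R : realType) (n : nat)
    (M : manifold R (4 * n + 3)) (phi : 'I_3 -> endo_field M)
    (xi : 'I_3 -> vector_field M) (eta : 'I_3 -> one_form M)
    (g : riemannian_metric M) (alpha delta : R) : Prop :=
  [/\ almost_3_contact_metric phi xi eta g,
      alpha != 0
    & for_even_perm (fun i j k =>
        forall (c : atlas M) (X Y : 'rV[R]_(4 * n + 3) -> 'rV[R]_(4 * n + 3)),
        smooth (cimg c) X -> smooth (cimg c) Y ->
        forall x, cimg c x ->
        ext_deriv (eta i c) X Y x =
          2 * alpha * fundamental_form g (phi i) c x (X x) (Y x)
          + 2 * (alpha - delta) * wedge (eta j c x) (eta k c x) (X x) (Y x))].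

Definition in_charts (R : realType) (m d : nat) (M : manifold R m)
    (N : manifold R d) (f : M -> N) (c : atlas M) (c' : atlas N) :
    'rV[R]_m -> 'rV[R]_d :=
  coord c' \o f \o param c.

Definition smooth_map (R : realType) (m d : nat) (M : manifold R m)
    (N : manifold R d) (U : set M) (f : M -> N) : Prop :=
  (forall p, U p -> {for p, continuous f}) /\
  forall c c',
    smooth (coord c @` (cdom c `&` U `&` f @^-1` cdom c')) (in_charts f c c').

Definition dmap (R : realType) (m d : nat) (M : manifold R m)
    (N : manifold R d) (f : M -> N) (c : atlas M) (c' : atlas N) (p : M)
    (v : 'rV[R]_m) : 'rV[R]_d :=
  'd (in_charts f c c') (coord c p) v.

Definition riemannian_submersion (R : realType) (m d : nat)
    (M : manifold R m) (N : manifold R d) (g : riemannian_metric M)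
    (gN : riemannian_metric N) (U : set M) (f : M -> N) : Prop :=
  smooth_map U f /\
  forall (c : atlas M) (c' : atlas N) (p : M),
    cdom c p -> U p -> cdom c' (f p) ->
    let df := dmap f c c' p in
    let horizontal u := forall w, df w = 0 -> g c (coord c p) w u = 0 in
    (forall y, exists v, df v = y) /\
    (forall u v, horizontal u -> horizontal v ->
       gN c' (coord c' (f p)) (df u) (df v) = g c (coord c p) u v).

(* U is the open subset of M on which the submersion is defined; the values
   of f outside U are irrelevant. *)
Definition canonical_submersion (R : realType) (m d : nat)
    (M : manifold R m) (N : manifold R d) (xi : 'I_3 -> vector_field M)
    (g : riemannian_metric M) (gN : riemannian_metric N)
    (U : set M) (f : M -> N) : Prop :=
  [/\ open U,
      riemannian_submersion g gN U f,
      f @` U = setT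
    & forall (c : atlas M) (c' : atlas N) (p : M),
        cdom c p -> U p -> cdom c' (f p) ->
        forall v, dmap f c c' p v = 0 <->
          exists a : 'I_3 -> R, v = \sum_i a i *: xi i c (coord c p)].

Definition smooth_section (R : realType) (m d : nat) (M : manifold R m)
    (N : manifold R d) (U : set M) (f : M -> N) (s : N -> M) : Prop :=
  smooth_map setT s /\ forall y, U (s y) /\ f (s y) = y.

(* The covariant derivative on an open subset of R^m with Christoffel
   symbols G. *)
Definition nabla (R : realType) (m : nat)
    (G : 'rV[R]_m -> 'rV[R]_m -> 'rV[R]_m -> 'rV[R]_m)
    (X Y : 'rV[R]_m -> 'rV[R]_m) (x : 'rV[R]_m) : 'rV[R]_m :=
  'D_(X x) Y x + G x (X x) (Y x).

Definition levi_civita (R : realType) (m : nat) (U : set 'rV[R]_m)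
    (g : 'rV[R]_m -> 'rV[R]_m -> 'rV[R]_m -> R)
    (G : 'rV[R]_m -> 'rV[R]_m -> 'rV[R]_m -> 'rV[R]_m) : Prop :=
  [/\ forall x u, U x -> linear (G x u) /\ linear (G x ^~ u),
      forall u v, smooth U (fun x => G x u v),
      forall X Y, smooth U X -> smooth U Y -> forall x, U x ->
        nabla G X Y x - nabla G Y X x = lie_bracket X Y x
    & forall X Y Z, smooth U X -> smooth U Y -> smooth U Z -> forall x, U x ->
        'D_(X x) (fun y => g y (Y y) (Z y)) x =
        g x (nabla G X Y x) (Z x) + g x (Y x) (nabla G X Z x)].

(* (g, J) is almost Hermitian and J is parallel for the Levi-Civita connection
   of g; by uniqueness of that connection it is enough to describe it in each
   chart. *)
Definition kahler (R : realType) (d : nat) (N : manifold R d)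
    (g : riemannian_metric N) (J : endo_field N) : Prop :=
  forall c : atlas N,
  [/\ forall x v, cimg c x -> J c x (J c x v) = - v,
      forall x u v, cimg c x -> g c x (J c x u) (J c x v) = g c x u v
    & exists G, levi_civita (cimg c) (g c) G /\
        forall X Y, smooth (cimg c) X -> smooth (cimg c) Y ->
        forall x, cimg c x ->
        nabla G X (fun y => J c y (Y y)) x = J c x (nabla G X Y x)].

Definition hyperkahler (R : realType) (d : nat) (N : manifold R d)
    (g : riemannian_metric N) : Prop :=
  exists J : 'I_3 -> endo_field N,
    (forall i, kahler g (J i)) /\
    for_even_perm (fun i j k =>
      forall (c : atlas N) (x v : 'rV[R]_d), cimg c x ->
      J i c x (J j c x v) = J k c x v /\ J j c x (J i c x v) = - J k c x v).

(* Main.v *)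
Require Import Defs.
From mathcomp Require Import all_boot all_order all_algebra perm.
From mathcomp Require Import all_classical all_reals all_analysis.
From mathcomp Require Import ring lra.
From HB Require Import structures.

(** The base carries three almost complex structures [J_i = pi_* phi_i s_*], where
    [s] is the given section. Since [phi_i] maps vertical vectors to vertical
    vectors and [s_*] is a right inverse of [pi_*], the algebraic identities of the
    [phi_i] modulo vertical vectors descend: the [J_i] are isometric for [gN] and
    satisfy the quaternion relations ([base_J_sqr], [base_J_isometry],
    [base_J_quaternion]). Their Kähler forms pull back to the horizontal parts
    [Phi_i + eta_j /\ eta_k] of the fundamental forms.

    For [delta = 0] the structure equation says exactly that this horizontal part
    is [d eta_i / (2 alpha)]. Therefore the Kähler form of [J_i] is
    [d (s^* eta_i) / (2 alpha)]: it is exact, hence closed ([base_J_form_closed]).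
    Working with the section avoids any discussion of the invariance of the
    structure along the fibres.

    The conclusion is Hitchin's lemma ([closed_kahler_forms_parallel]): if the
    three Kähler forms of an almost hyperhermitian structure are closed, then the
    three structures are parallel. The proof given here bypasses the integrability
    of the structures. For each one, closedness of its Kähler form implies the
    quasi-Kähler identity [nabla_(J X) J = (nabla_X J) J]
    ([closed_quasi_kahler]). Together with the derivatives of the quaternion
    relations, these identities force the three covariant derivatives to vanish at
    each point, by pure linear algebra ([quaternionic_variation_eq0]).

    The analytic prerequisites are the closure of smooth functions under algebraic
    operations and composition, the symmetry of second derivatives
    ([derive_comm]), the product rule for variable linear maps
    ([derive_linear_family]), the existence of the Levi-Civita connection in a
    chart ([levi_civita_christoffel]) and the chain rule in charts
    ([dmap_comp]). *)

Set Implicit Arguments.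
Unset Strict Implicit.
Unset Printing Implicit Defensive.

Import Order.TTheory GRing.Theory Num.Theory.
Import numFieldNormedType.Exports.

Local Open Scope classical_set_scope.
Local Open Scope ring_scope.

(** * Differential calculus on open subsets *)

Section Local.
Variables (R : realType) (V W : normedModType R).

Lemma near_eq_diff_differentiable (f g : V -> W) (a : V) :
  (\near a, f a = g a) -> differentiable f a ->
  'd g a = 'd f a :> (V -> W) /\ differentiable g a.
Proof.
move=> fg df; have [dfc /eqaddoP dfo] := (diff_locallyP a f).1 df.
have E : g \o shift a = cst (g a) + 'd f a +o_ 0 id.
  apply/eqaddoP => eps eps0; have := dfo _ eps0.
  have fgs : \forall h \near (0 : V), f (h + a) = g (h + a).
    by move: fg; rewrite (near_shift 0 a) /=; apply: filterS => h /=; rewrite subr0.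
  move=> H; near=> h.
  have -> : (g \o shift a - (cst (g a) + 'd f a)) h
          = (f \o shift a - (cst (f a) + 'd f a)) h.
    rewrite /= -(nbhs_singleton fg) /=; congr (_ - _).
    by rewrite /= (near fgs h).
  by near: h.
have dgE : 'd g a = 'd f a :> (V -> W) by apply: diff_unique.
split; first exact: dgE.
by apply/diff_locallyP; split; rewrite dgE.
Unshelve. all: by end_near. Qed.

Lemma near_eq_differentiable (f g : V -> W) (a : V) :
  (\near a, f a = g a) -> differentiable f a -> differentiable g a.
Proof. by move=> fg /(near_eq_diff_differentiable fg)[]. Qed.

Lemma near_eq_diff (f g : V -> W) (a : V) :
  (\near a, f a = g a) -> differentiable f a -> 'd g a = 'd f a :> (V -> W).
Proof. by move=> fg /(near_eq_diff_differentiable fg)[]. Qed.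

Lemma open_near (U : set V) (P : V -> Prop) x :
  open U -> U x -> (forall y, U y -> P y) -> \forall y \near x, P y.
Proof. by move=> oU Ux H; apply: filterS H _; apply: open_nbhs_nbhs. Qed.

End Local.

Section CkTheory.
Variables (R : realType) (m : nat).
Implicit Types (W : normedModType R) (U V : set 'rV[R]_m).

Lemma CkS W k U (f : 'rV[R]_m -> W) : Ck k.+1 U f -> Ck k U f.
Proof.
elim: k f => [|k IH] f.
  by case=> df _ x Ux; apply: differentiable_continuous; exact: df.
by case=> df Df; split=> // v; apply: IH.
Qed.

(** Every level of [Ck] is a pointwise condition on germs, so functions that
    agree on an open set are interchangeable there; most of the closure
    properties below rewrite a derivative on the open set and use this. *)
Lemma eq_Ck W k U (f g : 'rV[R]_m -> W) : open U ->
  (forall x, U x -> f x = g x) -> Ck k U f -> Ck k U g.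
Proof.
move=> oU; elim: k f g => [|k IH] f g fg /=.
  move=> fc x Ux; change (g @ x --> g x); rewrite -(fg x Ux).
  have fgx : {near x, f =1 g} := open_near oU Ux fg.
  exact: (cvg_trans (near_eq_cvg fgx) (fc x Ux)).
case=> df Df; split=> [x Ux|v].
  by apply: near_eq_differentiable (df _ Ux); exact: (open_near oU Ux fg).
apply: IH (Df v) => x Ux; apply: near_eq_derive; exact: (open_near oU Ux fg).
Qed.

(** Used for tensors that are given by a formula only in a neighbourhood of each
    point. *)
Lemma Ck_local W k U (f : 'rV[R]_m -> W) :
  (forall x, U x -> exists V, V x /\ Ck k V f) -> Ck k U f.
Proof.
elim: k f => [|k IH] f H /=.
  by move=> x /H[V [Vx]]; apply.
split=> [x /H[V [Vx [df _]]]|v]; first exact: df.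
by apply: IH => x /H[V [Vx [_ Df]]]; exists V; split; [exact: Vx|exact: Df].
Qed.

Lemma Ck_cst W k U (a : W) : Ck k U (fun=> a).
Proof.
elim: k a => [|k IH] a /=; first by move=> x _; exact: cst_continuous.
split=> [x _|v]; first exact: differentiable_cst.
have -> : (fun x => 'D_v (fun=> a) x) = (fun=> 0 : W); last exact: IH.
by apply/funext => x; exact: derive_cst.
Qed.

Lemma CkD W k U (f g : 'rV[R]_m -> W) : open U ->
  Ck k U f -> Ck k U g -> Ck k U (fun x => f x + g x).
Proof.
move=> oU; elim: k f g => [|k IH] f g /=.
  by move=> fc gc x Ux; exact: (cvgD (fc x Ux) (gc x Ux)).
case=> df Df [dg Dg]; split=> [x Ux|v].
  by apply: differentiableD; [exact: df|exact: dg].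
apply: eq_Ck (IH _ _ (Df v) (Dg v)) => // x Ux.
by rewrite -deriveD//; apply: diff_derivable; [exact: df|exact: dg].
Qed.

Lemma CkM k U (f g : 'rV[R]_m -> R) : open U ->
  Ck k U f -> Ck k U g -> Ck k U (fun x => f x * g x).
Proof.
move=> oU; elim: k f g => [|k IH] f g.
  by move=> fc gc x Ux; exact: (cvgM (fc x Ux) (gc x Ux)).
move=> Cf Cg; have [df Df] := Cf; have [dg Dg] := Cg; split=> [x Ux|v].
  by apply: differentiableM; [exact: df|exact: dg].
apply: (@eq_Ck _ _ _ (fun x => f x * 'D_v g x + g x * 'D_v f x)) => // [x Ux|].
  by rewrite deriveM//; apply: diff_derivable; [exact: df|exact: dg].
exact: (CkD oU (IH _ _ (CkS Cf) (Dg v)) (IH _ _ (CkS Cg) (Df v))).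
Qed.

Lemma Ck_lin W W' k U (L : {linear W -> W'}) (f : 'rV[R]_m -> W) : open U ->
  continuous L -> Ck k U f -> Ck k U (fun x => L (f x)).
Proof.
move=> oU cL; elim: k f => [|k IH] f /=.
  by move=> fc x Ux; apply: (@continuous_comp _ _ _ f L); [exact: fc x Ux|exact: cL].
case=> df Df; split=> [x Ux|v].
  apply: (@differentiable_comp _ _ _ _ f L); first exact: df.
  exact: linear_differentiable.
apply: eq_Ck (IH _ (Df v)) => // x Ux.
have dL y : differentiable L y by exact: linear_differentiable.
have dfx := df x Ux.
rewrite [RHS](_ : _ = 'D_v (L \o f) x)// deriveE// deriveE; last first.
  exact: (differentiable_comp dfx (dL _)).
by rewrite (diff_comp dfx (dL _)) /= (diff_lin _ cL).
Qed.

Lemma CkZr W k U (f : 'rV[R]_m -> R) (w : W) : open U ->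
  Ck k U f -> Ck k U (fun x => f x *: w).
Proof.
have w_lin : linear (fun a : R => a *: w).
  by move=> a b c; rewrite scalerDl scalerA.
pose LM := GRing.isLinear.Build _ _ _ _ _ w_lin.
pose L : {linear R -> W} := HB.pack (fun a : R => a *: w) LM.
move=> oU; exact: (@Ck_lin _ _ _ _ L _ oU (@scalel_continuous _ _ w)).
Qed.

Lemma CkZ W k U (f : 'rV[R]_m -> W) (a : R) : open U ->
  Ck k U f -> Ck k U (fun x => a *: f x).
Proof.
move=> oU; pose L : {linear W -> W} := *:%R a.
exact: (@Ck_lin _ _ _ _ L _ oU (@scaler_continuous _ _ a)).
Qed.

Lemma Ck_coord n p k U (f : 'rV[R]_m -> 'M[R]_(n, p)) i j : open U ->
  Ck k U f -> Ck k U (fun x => f x i j).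
Proof.
have @L : {linear 'M[R]_(n, p) -> R}.
  by exists (fun N : 'M[R]_(_, _) => N i j); do 2![eexists]; do ?[constructor];
     rewrite ?mxE// => ? *; rewrite ?mxE//; move=> ?; rewrite !mxE.
move=> oU; apply: (@Ck_lin _ _ _ _ L _ oU); exact: coord_continuous.
Qed.

Lemma Ck_sum W k U (I : Type) (r : seq I) (P : pred I)
    (f : I -> 'rV[R]_m -> W) : open U ->
  (forall i, Ck k U (f i)) -> Ck k U (fun x => \sum_(i <- r | P i) f i x).
Proof.
move=> oU Cf; elim: r => [|i r IH].
  by apply: eq_Ck (Ck_cst k U (0 : W)) => // x _; rewrite big_nil.
apply: (@eq_Ck _ _ _ (fun x => (if P i then f i x else 0) +
                               \sum_(i <- r | P i) f i x)) => //.
  by move=> x _; rewrite big_cons; case: ifP => // _; rewrite add0r.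
apply: CkD => //; case: (P i); [exact: Cf|exact: Ck_cst].
Qed.

Lemma Ck_prod k U (I : Type) (r : seq I) (P : pred I)
    (f : I -> 'rV[R]_m -> R) : open U ->
  (forall i, Ck k U (f i)) -> Ck k U (fun x => \prod_(i <- r | P i) f i x).
Proof.
move=> oU Cf; elim: r => [|i r IH].
  by apply: eq_Ck (Ck_cst k U (1 : R)) => // x _; rewrite big_nil.
apply: (@eq_Ck _ _ _ (fun x => (if P i then f i x else 1) *
                               \prod_(i <- r | P i) f i x)) => //.
  by move=> x _; rewrite big_cons; case: ifP => // _; rewrite mul1r.
apply: CkM => //; case: (P i); [exact: Cf|exact: Ck_cst].
Qed.

Lemma Ck_row d k U (f : 'rV[R]_m -> 'rV[R]_d) : open U ->
  (forall j, Ck k U (fun x => f x 0 j)) -> Ck k U f.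
Proof.
move=> oU Cf.
apply: (@eq_Ck _ _ _ (fun x => \sum_j f x 0 j *: delta_mx 0 j)) => //.
  by move=> x _; rewrite -row_sum_delta.
by apply: Ck_sum => // j; apply: CkZr => //; exact: Cf.
Qed.

Lemma CkV k U (f : 'rV[R]_m -> R) : open U -> (forall x, U x -> f x != 0) ->
  Ck k U f -> Ck k U (fun x => (f x)^-1).
Proof.
move=> oU f0; elim: k f f0 => [|k IH] f f0.
  by move=> fc x Ux; apply: (cvgV (f0 x Ux) (fc x Ux)).
move=> Cf; have [df Df] := Cf; split=> [x Ux|v].
  by apply: differentiableV; [exact: df|exact: f0].
apply: (@eq_Ck _ _ _ (fun x => - 1 *: ((f x)^-1 * (f x)^-1 * 'D_v f x))) => //.
  move=> x Ux; rewrite deriveV; [|exact: f0|exact: diff_derivable (df x Ux)].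
  by rewrite /GRing.scale/= mulN1r -invfM -expr2 mulNr.
have CV := IH f f0 (CkS Cf).
exact: (CkZ _ oU (CkM oU (CkM oU CV CV) (Df v))).
Qed.

End CkTheory.

Section Composition.
Variables (R : realType) (m d : nat).

Lemma derive_delta (W : normedModType R) (f : 'rV[R]_m -> W) x v :
  differentiable f x -> 'D_v f x = \sum_j v 0 j *: 'D_(delta_mx 0 j) f x.
Proof.
move=> df; rewrite deriveE// {1}(row_sum_delta v) linear_sum.
by apply: eq_bigr => j _; rewrite linearZ deriveE.
Qed.

Lemma derive_comp (W : normedModType R) (h : 'rV[R]_m -> 'rV[R]_d)
    (f : 'rV[R]_d -> W) x v :
  differentiable h x -> differentiable f (h x) ->
  'D_v (fun y => f (h y)) x = 'D_('D_v h x) f (h x).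
Proof.
move=> dh df; rewrite [LHS](_ : _ = 'D_v (f \o h) x)//.
by rewrite !deriveE//; [rewrite diff_comp|exact: differentiable_comp].
Qed.

End Composition.

Section CompositionCk.
Variables (R : realType) (m d : nat).
Variables (U : set 'rV[R]_m) (V : set 'rV[R]_d) (h : 'rV[R]_m -> 'rV[R]_d).
Hypotheses (oU : open U) (hUV : forall x, U x -> V (h x)).

(** By induction on [k]: the chain rule expresses a derivative of the composite
    through products of derivatives of [h] with composites of the partial
    derivatives of [f], which are one degree less regular. *)
Lemma Ck_comp1 k (f : 'rV[R]_d -> R) :
  Ck k V f -> Ck k U h -> Ck k U (fun x => f (h x)).
Proof.
elim: k f => [|k IH] f Cf Ch.
  move=> x Ux; apply: (@continuous_comp _ _ _ h f).
    exact: Ch.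
  exact: Cf (hUV Ux).
have [df Df] := Cf; have [dh Dh] := Ch; split=> [x Ux|v].
  exact: (differentiable_comp (dh x Ux) (df _ (hUV Ux))).
apply: (@eq_Ck _ _ _ _ _ (fun x =>
  \sum_j 'D_v h x 0 j * 'D_(delta_mx 0 j) f (h x))) => //.
  move=> x Ux; rewrite (derive_comp v (dh x Ux) (df _ (hUV Ux))).
  by rewrite (derive_delta _ (df _ (hUV Ux))).
apply: Ck_sum => // j; apply: CkM => //; first exact: Ck_coord (Dh v).
exact: IH (Df _) (CkS Ch).
Qed.

End CompositionCk.

(** * Symmetry of second derivatives *)

Section Schwarz.
Variables (R : realType) (m : nat).
Implicit Types (U : set 'rV[R]_m) (f : 'rV[R]_m -> R) (x u v : 'rV[R]_m).

Lemma is_derive_line f x u (a : R) : differentiable f (x + a *: u) ->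
  is_derive a 1 (fun b : R => f (x + b *: u)) ('D_u f (x + a *: u)).
Proof.
move=> df; have H := differentiableP df.
have dl : is_diff a (fun b : R => x + b *: u) (fun b => b *: u).
  by apply: is_diff_eq; rewrite add0r.
have dc : is_diff a (f \o (fun b : R => x + b *: u))
                  ('d f (x + a *: u) \o (fun b => b *: u)).
  exact: is_diff_comp.
apply: DeriveDef.
  exact: (@diff_derivable _ _ _ (f \o (fun b : R => x + b *: u))).
rewrite [LHS](_ : _ = 'D_1 (f \o (fun b : R => x + b *: u)) a)//.
by rewrite deriveE// diff_val /= scale1r deriveE.
Qed.

Lemma MVT_line f x u (t : R) : 0 < t ->
  (forall a, 0 <= a <= t -> differentiable f (x + a *: u)) ->
  exists2 c, 0 < c < t & f (x + t *: u) - f x = 'D_u f (x + c *: u) * t.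
Proof.
move=> t0 df; have := @MVT R (fun b : R => f (x + b *: u))
  (fun a => 'D_u f (x + a *: u)) 0 t t0.
case.
- move=> a; rewrite in_itv /= => /andP[a0 at_].
  by apply: is_derive_line; apply: df; rewrite !ltW.
- apply/continuous_in_subspaceT => a; rewrite inE/= in_itv/= => at_.
  have /(@is_derive_line _ _ _ _)[/derivable1_diffP dfa _] := df _ at_.
  exact: differentiable_continuous.
by move=> c; rewrite in_itv/= scale0r addr0 subr0 => ct E; exists c.
Qed.

(** Two applications of the mean value theorem, first along [u] to the increment
    of [f] in the direction [v], then along [v] to the derivative of [f] along
    [u], write the second difference as [t * t] times a second derivative at a
    point close to [x], where that derivative is continuous. *)
Lemma second_difference_cvg U f x u v (e : R) : open U -> U x -> Ck 2 U f ->
  0 < e -> exists2 r : R, 0 < r & forall t : R, 0 < t < r ->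
  `|(f (x + t *: u + t *: v) - f (x + t *: u) - f (x + t *: v) + f x)
     - 'D_v ('D_u f) x * (t * t)| < e * (t * t).
Proof.
move=> oU Ux [df D2] e0; have [dDf D3] := D2 u.
have cD : {for x, continuous ('D_v ('D_u f))} := D3 v x Ux.
have Ux' : \forall y \near x, U y by apply: open_near oU Ux _.
have /nbhs_ballP[r r0 H] : \forall y \near x, U y /\
    `|'D_v ('D_u f) x - 'D_v ('D_u f) y| < e.
  have cDe := (cvgrPdist_lt _ _).1 cD e e0.
  exact: (@filterI _ (nbhs x) _ _ _ Ux' (cDe _)).
(* The summand 1 keeps the denominator positive when u = v = 0. *)
have n0 : 0 < `|u| + `|v| + 1 by rewrite ltr_wpDl// addr_ge0.
have Hin (a b t : R) : 0 <= a <= t -> 0 <= b <= t -> t < r / (`|u| + `|v| + 1) ->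
    ball x r (x + a *: u + b *: v).
  move=> /andP[a0 at_] /andP[b0 bt]; rewrite ltr_pdivlMr// => tr.
  rewrite -ball_normE /= -addrA opprD addNKr normrN.
  apply: le_lt_trans tr; rewrite (le_trans (ler_normD _ _))// !normrZ.
  rewrite !ger0_norm// 2!mulrDr mulr1 ler_wpDr ?(le_trans a0)//.
  by rewrite lerD// ler_wpM2r.
exists (r / (`|u| + `|v| + 1)); first exact: divr_gt0.
move=> /= t /andP[t0 tr]; have tt : 0 <= t <= t by apply/andP; split; [exact: ltW|].
have t00 : 0 <= (0 : R) <= t by apply/andP; split; [|exact: ltW].
pose phi (y : 'rV[R]_m) := f (y + t *: v) - f y.
have dphi (y : 'rV[R]_m) : differentiable f (y + t *: v) -> differentiable f y ->
    differentiable phi y /\ 'D_u phi y = 'D_u f (y + t *: v) - 'D_u f y.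
  move=> df1 df2.
  have ds : is_diff y (fun z => z + t *: v) id.
    by apply: is_diff_eq; rewrite addr0.
  have dc : differentiable (f \o (fun z => z + t *: v)) y.
    exact: differentiable_comp.
  split; first exact: (differentiableB dc df2).
  rewrite /phi [LHS](_ : _ = 'D_u ((f \o (fun z => z + t *: v)) - f) y)//.
  rewrite deriveB; [|exact: diff_derivable|exact: diff_derivable].
  congr (_ - _); rewrite deriveE// diff_comp//= diff_val deriveE//.
have Uxab (a b : R) : 0 <= a <= t -> 0 <= b <= t -> U (x + a *: u + b *: v).
  by move=> at_ bt; have [] := H _ (Hin a b t at_ bt tr).
have Uxa (a : R) : 0 <= a <= t -> U (x + a *: u).
  by move=> /Uxab/(_ t00); rewrite scale0r addr0.
have [c ct Ec] := @MVT_line phi x u t t0 (fun a at_ =>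
  (dphi _ (df _ (Uxab _ _ at_ tt)) (df _ (Uxa _ at_))).1).
have ct' : 0 <= c <= t by case/andP: ct => c0 c1; apply/andP; split; exact: ltW.
rewrite (dphi _ (df _ (Uxab _ _ ct' tt)) (df _ (Uxa _ ct'))).2 in Ec.
have [c' ct1 Ec'] := @MVT_line ('D_u f) (x + c *: u) v t t0 (fun b bt =>
  dDf _ (Uxab _ _ ct' bt)).
have ct1' : 0 <= c' <= t.
  by case/andP: ct1 => c0 c1; apply/andP; split; exact: ltW.
rewrite Ec' in Ec.
have -> : f (x + t *: u + t *: v) - f (x + t *: u) - f (x + t *: v) + f x =
  phi (x + t *: u) - phi x by rewrite /phi; ring.
rewrite Ec -mulrA -mulrBl normrM (gtr0_norm (mulr_gt0 t0 t0)).
rewrite ltr_pM2r ?mulr_gt0// distrC.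
by have [] := H _ (Hin c c' t ct' ct1' tr).
Qed.

(** The second difference is symmetric in the two directions, hence so is the
    limit of its quotient by [t * t]. *)
Lemma derive_comm U f x u v : open U -> U x -> Ck 2 U f ->
  'D_u ('D_v f) x = 'D_v ('D_u f) x.
Proof.
move=> oU Ux Cf.
have Huv e := @second_difference_cvg U f x u v e oU Ux Cf.
have Hvu e := @second_difference_cvg U f x v u e oU Ux Cf.
move: ('D_u ('D_v f) x : R) ('D_v ('D_u f) x : R) Huv Hvu => a b Huv Hvu.
apply/eqP/negPn/negP => ab.
have e0 : 0 < `|a - b| by rewrite normr_gt0 subr_eq0.
have e20 : 0 < `|a - b| / 2 by rewrite divr_gt0.
have [r r0 Hr] := Huv _ e20; have [r' r'0 Hr'] := Hvu _ e20.
have m0 : 0 < Num.min r r' by rewrite lt_min r0.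
have [t t0 tm] : exists2 t : R, 0 < t & t < Num.min r r'.
  by exists (Num.min r r' / 2); [rewrite divr_gt0|rewrite ltr_pdivrMr; lra].
have /andP[tr tr'] : (t < r) && (t < r') by rewrite -lt_min.
have tt0 : 0 < t * t by rewrite mulr_gt0.
have /Hr h : 0 < t < r by rewrite t0.
have /Hr' h' : 0 < t < r' by rewrite t0.
have : `|a - b| * (t * t) < `|a - b| * (t * t).
  rewrite -{1}(gtr0_norm tt0) -normrM (splitr `|a - b|) [ltRHS]mulrDl.
  apply: le_lt_trans (ltrD h h'); apply: le_trans (ler_normB _ _).
  rewrite (addrAC x (t *: v)) le_eqVlt; apply/orP; left; apply/eqP.
  congr `|_|; ring.
by rewrite ltxx.
Qed.
End Schwarz.

(** * Families of linear maps *)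

Section LinearFunctions.
Variables (R : realType) (V W : lmodType R) (f : V -> W).
Hypothesis lf : linear f.

Lemma linf0 : f 0 = 0.
Proof. by have := lf (- 1) 0 0; rewrite !scaleN1r !addNr. Qed.

Lemma linfD u v : f (u + v) = f u + f v.
Proof. by have := lf 1 u v; rewrite !scale1r. Qed.

Lemma linfZ a u : f (a *: u) = a *: f u.
Proof. by have := lf a u 0; rewrite linf0 !addr0. Qed.

Lemma linfN u : f (- u) = - f u.
Proof. by rewrite -[- u]scaleN1r linfZ scaleN1r. Qed.

Lemma linfB u v : f (u - v) = f u - f v.
Proof. by rewrite linfD linfN. Qed.
End LinearFunctions.

Section Coordinates.
Variables (R : realType) (m d : nat).

Lemma lin_sum_delta (W : lmodType R) (f : 'rV[R]_d -> W) v : linear f ->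
  f v = \sum_j v 0 j *: f (delta_mx 0 j).
Proof.
move=> lf; pose LM := GRing.isLinear.Build _ _ _ _ _ lf.
pose L : {linear 'rV[R]_d -> W} := HB.pack f LM.
rewrite -[LHS]/(L v) {1}(row_sum_delta v) linear_sum.
by apply: eq_bigr => j _; rewrite linearZ.
Qed.

Lemma derive_coord (f : 'rV[R]_m -> 'rV[R]_d) x u j : differentiable f x ->
  ('D_u f x) 0 j = 'D_u (fun y => f y 0 j) x.
Proof. by move=> df; rewrite derive_mx ?mxE//; exact: diff_derivable. Qed.

Lemma differentiable_coordr (f : 'rV[R]_m -> 'rV[R]_d) x j :
  differentiable f x -> differentiable (fun y => f y 0 j) x.
Proof.
by move=> df; exact: (differentiable_comp df (differentiable_coord (f x) 0 j)).
Qed.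

Lemma differentiable_row (f : 'rV[R]_m -> 'rV[R]_d) x :
  (forall j, differentiable (fun y => f y 0 j) x) -> differentiable f x.
Proof.
move=> df.
have -> : f = \sum_j (fun y => f y 0 j *: delta_mx 0 j).
  by apply/funext => y; rewrite fct_sumE -row_sum_delta.
by apply: differentiable_sum => j; exact: differentiableZl (df j).
Qed.
End Coordinates.

Section LinearFamilies.
Variables (R : realType) (m d : nat).
Variables (U : set 'rV[R]_m) (x : 'rV[R]_m) (Y : 'rV[R]_m -> 'rV[R]_d).
Hypotheses (oU : open U) (Ux : U x) (dY : differentiable Y x).

(** Product rule for the evaluation of a variable linear form at a variable
    vector; expanding the vector in the standard basis reduces it to products of
    scalar functions. *)
Lemma derive_scalar_family (L : 'rV[R]_m -> 'rV[R]_d -> R) u :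
  (forall y, U y -> scalar (L y)) ->
  (forall v, differentiable (L ^~ v) x) ->
  differentiable (fun y => L y (Y y)) x /\
  'D_u (fun y => L y (Y y)) x = 'D_u (L ^~ (Y x)) x + L x ('D_u Y x).
Proof.
move=> linL dL.
pose F := \sum_j (fun y => Y y 0 j * L y (delta_mx 0 j)).
have dYj j := differentiable_coordr j dY.
have dFj j : differentiable (fun y => Y y 0 j * L y (delta_mx 0 j)) x.
  exact: (differentiableM (dYj j) (dL _)).
have FE : \forall y \near x, F y = L y (Y y).
  apply: (open_near oU Ux) => y Uy; rewrite /F fct_sumE.
  by rewrite (lin_sum_delta (Y y) (linL y Uy)).
have dF : differentiable F x by apply: differentiable_sum.
split; first exact: near_eq_differentiable FE dF.
rewrite -(near_eq_derive _ FE) /F derive_sum; last first.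
  by move=> j; apply: diff_derivable.
pose G := \sum_j (fun y => Y x 0 j * L y (delta_mx 0 j)).
have dGj j : differentiable (fun y => Y x 0 j * L y (delta_mx 0 j)) x.
  exact: (differentiableM (differentiable_cst _ _) (dL _)).
have GE : \forall y \near x, G y = L y (Y x).
  apply: (open_near oU Ux) => y Uy; rewrite /G fct_sumE.
  by rewrite (lin_sum_delta (Y x) (linL y Uy)).
rewrite -(near_eq_derive _ GE) /G derive_sum; last first.
  by move=> j; apply: diff_derivable.
rewrite (lin_sum_delta ('D_u Y x) (linL x Ux)) -big_split /=.
apply: eq_bigr => j _; rewrite (derive_coord _ _ dY).
have dLj : derivable (L ^~ (delta_mx 0 j)) x u := diff_derivable (dL _).
have dYu : derivable (fun y => Y y 0 j) x u := diff_derivable (dYj j).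
rewrite [LHS](deriveM dYu dLj) [X in _ = X + _](deriveMl (Y x 0 j) dLj).
congr (_ + _).
by rewrite /GRing.scale /= mulrC.
Qed.

Lemma derive_linear_family e (L : 'rV[R]_m -> 'rV[R]_d -> 'rV[R]_e) u :
  (forall y, U y -> linear (L y)) ->
  (forall v, differentiable (L ^~ v) x) ->
  differentiable (fun y => L y (Y y)) x /\
  'D_u (fun y => L y (Y y)) x = 'D_u (L ^~ (Y x)) x + L x ('D_u Y x).
Proof.
move=> linL dL.
have linLj j y : U y -> scalar (fun v => L y v 0 j).
  by move=> Uy a v w; rewrite linL// !mxE.
have H j := @derive_scalar_family (fun y v => L y v 0 j) u (linLj j)
  (fun v => differentiable_coordr j (dL v)).
have dLY : differentiable (fun y => L y (Y y)) x.
  by apply: differentiable_row => j; exact: (H j).1.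
split=> //; apply/rowP => j; rewrite mxE (derive_coord _ _ dLY) (H j).2.
by rewrite (derive_coord _ _ (dL _)).
Qed.
End LinearFamilies.

(** * Smooth functions on an open set *)

Section SmoothTheory.
Variables (R : realType) (m : nat) (U : set 'rV[R]_m).
Hypothesis oU : open U.

Lemma smooth_diff (W : normedModType R) (f : 'rV[R]_m -> W) x :
  smooth U f -> U x -> differentiable f x.
Proof. by move=> Cf Ux; have [df _] := Cf 1%N; exact: df. Qed.

Lemma smooth_derive (W : normedModType R) (f : 'rV[R]_m -> W) v :
  smooth U f -> smooth U (fun x => 'D_v f x).
Proof. by move=> Cf k; have [_ Df] := Cf k.+1; exact: Df. Qed.

Lemma smooth_cst (W : normedModType R) (a : W) : smooth U (fun=> a).
Proof. by move=> k; exact: Ck_cst. Qed.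

Lemma eq_smooth (W : normedModType R) (f g : 'rV[R]_m -> W) :
  (forall x, U x -> f x = g x) -> smooth U f -> smooth U g.
Proof. by move=> fg Cf k; exact: eq_Ck (Cf k). Qed.

Lemma smoothD (W : normedModType R) (f g : 'rV[R]_m -> W) :
  smooth U f -> smooth U g -> smooth U (fun x => f x + g x).
Proof. by move=> Cf Cg k; exact: CkD. Qed.

Lemma smoothZ (W : normedModType R) (f : 'rV[R]_m -> W) a :
  smooth U f -> smooth U (fun x => a *: f x).
Proof. by move=> Cf k; exact: CkZ. Qed.

Lemma smooth_scalar_family d (L : 'rV[R]_m -> 'rV[R]_d -> R)
    (Y : 'rV[R]_m -> 'rV[R]_d) :
  (forall y, U y -> scalar (L y)) -> (forall v, smooth U (L ^~ v)) ->
  smooth U Y -> smooth U (fun y => L y (Y y)).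
Proof.
move=> linL CL CY.
apply: (@eq_smooth _ (fun y => \sum_j Y y 0 j * L y (delta_mx 0 j))).
  by move=> y Uy; rewrite (lin_sum_delta (Y y) (linL y Uy)).
move=> k; apply: Ck_sum => // j; apply: CkM => //; first exact: Ck_coord (CY k).
exact: CL.
Qed.

Lemma smooth_linear_family d e (L : 'rV[R]_m -> 'rV[R]_d -> 'rV[R]_e)
    (Y : 'rV[R]_m -> 'rV[R]_d) :
  (forall y, U y -> linear (L y)) -> (forall v, smooth U (L ^~ v)) ->
  smooth U Y -> smooth U (fun y => L y (Y y)).
Proof.
move=> linL CL CY k; apply: Ck_row => // j.
apply: (@smooth_scalar_family d (fun y v => L y v 0 j)) => //.
  by move=> y Uy a v w; rewrite linL// !mxE.
by move=> v l; exact: Ck_coord (CL v l).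
Qed.

Lemma smooth_comp d e (V : set 'rV[R]_d) (h : 'rV[R]_m -> 'rV[R]_d)
    (f : 'rV[R]_d -> 'rV[R]_e) : open V ->
  (forall x, U x -> V (h x)) -> smooth V f -> smooth U h ->
  smooth U (fun x => f (h x)).
Proof.
move=> oV hUV Cf Ch k; apply: Ck_row => // j.
exact: (Ck_comp1 oU hUV (Ck_coord _ j oV (Cf k)) (Ch k)).
Qed.

Lemma smooth_comp1 d (V : set 'rV[R]_d) (h : 'rV[R]_m -> 'rV[R]_d)
    (f : 'rV[R]_d -> R) :
  (forall x, U x -> V (h x)) -> smooth V f -> smooth U h ->
  smooth U (fun x => f (h x)).
Proof. by move=> hUV Cf Ch k; exact: (Ck_comp1 oU hUV (Cf k) (Ch k)). Qed.

Lemma smooth_derive_comm (f : 'rV[R]_m -> R) u v x : smooth U f -> U x ->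
  'D_u ('D_v f) x = 'D_v ('D_u f) x.
Proof. by move=> Cf Ux; apply: (derive_comm _ _ oU Ux (Cf 2%N)). Qed.

Lemma smooth_derive_comm_row d (f : 'rV[R]_m -> 'rV[R]_d) u v x :
  smooth U f -> U x -> 'D_u ('D_v f) x = 'D_v ('D_u f) x.
Proof.
move=> Cf Ux; apply/rowP => j.
have Cfj : smooth U (fun y => f y 0 j) by move=> k; exact: Ck_coord (Cf k).
have E w z : 'D_w ('D_z f) x 0 j = 'D_w ('D_z (fun y => f y 0 j)) x.
  rewrite derive_coord; last exact: smooth_diff (smooth_derive z Cf) Ux.
  apply: near_eq_derive; apply: (open_near oU Ux) => y Uy.
  by rewrite derive_coord//; exact: smooth_diff Cf Uy.
have C := smooth_derive_comm u v Cfj Ux.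
exact: (eq_trans (E u v) (eq_trans C (esym (E v u)))).
Qed.
End SmoothTheory.

(** * Even permutations of three indices *)

Section EvenPermutations.
Local Open Scope group_scope.

Lemma for_even_perm_cycles (P : 'I_3 -> 'I_3 -> 'I_3 -> Prop) :
  for_even_perm P ->
  [/\ P ord0 1%R 2%R, P 1%R 2%R ord0 & P 2%R ord0 1%R].
Proof.
move=> HP; split.
- by have := HP 1; rewrite odd_perm1 !perm1; apply.
- have := HP (tperm 0%R 1%R * tperm 0%R 2%R).
  rewrite odd_permM !odd_tperm !permM => /(_ isT).
  by rewrite !permE /=.
- have := HP (tperm 0%R 2%R * tperm 0%R 1%R).
  rewrite odd_permM !odd_tperm !permM => /(_ isT).
  by rewrite !permE /=.
Qed.

(** Completes an index to a positively oriented triple, for which everything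
    known about even permutations holds in all three cyclic orders, and whose
    members exhaust the indices of a sum. *)
Lemma even_perm_completion (i : 'I_3) : exists j k : 'I_3,
  (forall P, for_even_perm P -> [/\ P i j k, P j k i & P k i j]) /\
  (forall (V : zmodType) (F : 'I_3 -> V), (\sum_l F l = F i + F j + F k)%R).
Proof.
have S (V : zmodType) (F : 'I_3 -> V) : (\sum_l F l = F ord0 + F 1 + F 2)%R.
  rewrite !big_ord_recl big_ord0 GRing.addr0 GRing.addrA.
  by congr (_ + F _ + F _)%R; apply: val_inj.
case: i => [[|[|[|i]]]] // Hi.
- exists 1%R, 2%R; rewrite (_ : Ordinal Hi = ord0); last exact: val_inj.
  by split=> // P /for_even_perm_cycles[].
- exists 2%R, ord0; rewrite (_ : Ordinal Hi = 1%R); last exact: val_inj.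
  split=> [P /for_even_perm_cycles[]|V F] //.
  by rewrite S -GRing.addrA GRing.addrC.
- exists ord0, 1%R; rewrite (_ : Ordinal Hi = 2%R); last exact: val_inj.
  split=> [P /for_even_perm_cycles[]|V F] //.
  by rewrite S GRing.addrC GRing.addrA.
Qed.
End EvenPermutations.

(** * The linear algebra of Hitchin's lemma *)

Section HitchinAlgebra.
Variables (R : realType) (V : lmodType R).

Lemma self_opp0 (w : V) : w = - w -> w = 0.
Proof.
move=> ww; have : 2%:R *: w = 0.
  by rewrite scaler_nat mulr2n {2}ww subrr.
by move/eqP; rewrite scaler_eq0 pnatr_eq0 /= => /eqP.
Qed.

Lemma half_inj (w z : V) : w + w = z + z -> w = z.
Proof.
move=> E; apply/eqP; rewrite -subr_eq0; apply/eqP; apply: self_opp0.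
by apply/eqP; rewrite -addr_eq0 addrACA E -opprD subrr.
Qed.

(** Abstracts a point of an almost hyperhermitian manifold with closed Kähler
    forms: [Ji] are the three structures and [Ai X w] stands for the covariant
    derivative of [Ji] along [X], evaluated at [w]. The fields [qv_A3] and
    [qv_anti] differentiate [J3 = J1 J2] and [J1 J1 = - 1]; the fields [qv_qk] are
    what closedness gives for a single structure. *)
Record quaternionic_variation (J1 J2 J3 : V -> V) (A1 A2 A3 : V -> V -> V) :
    Prop := {
  qv_J1 : linear J1;
  qv_J2 : linear J2;
  qv_A1 : forall w, linear (A1 ^~ w);
  qv_A1r : forall X, linear (A1 X);
  qv_A2 : forall w, linear (A2 ^~ w);
  qv_A2r : forall X, linear (A2 X);
  qv_J1K : forall w, J1 (J1 w) = - w;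
  qv_J2K : forall w, J2 (J2 w) = - w;
  qv_J12 : forall w, J3 w = J1 (J2 w);
  qv_J21 : forall w, J3 w = - J2 (J1 w);
  qv_A3 : forall X w, A3 X w = A1 X (J2 w) + J1 (A2 X w);
  qv_anti : forall X w, A1 X (J1 w) = - J1 (A1 X w);
  qv_qk1 : forall X w, A1 (J1 X) w = A1 X (J1 w);
  qv_qk2 : forall X w, A2 (J2 X) w = A2 X (J2 w);
  qv_qk3 : forall X w, A3 (J3 X) w = A3 X (J3 w)
}.

(** Inserting [J3 X = J1 J2 X = - J2 J1 X] in the identity [qv_qk3] and expanding
    [A3] by [qv_A3] gives one relation between [A1 (J2 X)] and [A2 (J1 X)];
    replacing [X] by [J1 X] in it gives a second one, and the two determine both
    terms. *)
Lemma quaternionic_variation_cross J1 J2 J3 A1 A2 A3 :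
  quaternionic_variation J1 J2 J3 A1 A2 A3 ->
  (forall X w, A1 (J2 X) w = - A1 X (J2 w)) /\
  (forall X w, A2 (J1 X) w = - A2 X (J1 w)).
Proof.
case=> lJ1 lJ2 lA1 lA1r lA2 lA2r J1K J2K J12 J21 E3 anti qk1 qk2 qk3.
have J12N w : J1 (J2 w) = - J2 (J1 w) by rewrite -J12 J21.
have N1 w : J1 (- w) = - J1 w by exact: linfN.
have N2 w : J2 (- w) = - J2 w by exact: linfN.
have NA1 X w : A1 X (- w) = - A1 X w by rewrite (linfN (lA1r X)).
have NA2 X w : A2 X (- w) = - A2 X w by rewrite (linfN (lA2r X)).
have NA1l X w : A1 (- X) w = - A1 X w by apply: (linfN (lA1 w) X).
have NA2l X w : A2 (- X) w = - A2 X w by apply: (linfN (lA2 w) X).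
have alpha X w : - A1 (J2 X) (J1 w) + J1 (A2 (J1 X) w) =
    A1 X (J3 w) - J1 (A2 X (J1 w)).
  rewrite J21 NA1; have := qk3 X (J2 w).
  rewrite !E3 !J12 qk1 (J12N X) NA2l qk2 !J2K.
  by rewrite !(N1, N2, NA1, NA2, NA1l, NA2l, opprK).
have beta X w : A1 (J2 X) w + A2 (J1 X) w = - A1 X (J2 w) - A2 X (J1 w).
  have := congr1 J1 (alpha X w); rewrite !(linfD lJ1) !N1 !J1K opprK J12.
  rewrite !anti !N1 !J1K !opprK -opprD => E.
  by rewrite -[LHS]opprK E opprD.
have gamma X w : A1 (J2 X) w - A2 (J1 X) w = A2 X (J1 w) - A1 X (J2 w).
  have := beta (J1 X) (J1 w).
  rewrite -[J2 (J1 X)]opprK -J12N NA1l !J1K NA2l !qk1 !J1K J12N J1K.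
  rewrite !(N2, NA1, NA2, opprK) => E.
  by rewrite -[X in X - _](subrK (A2 X (J1 w))) E addrAC addrK addrC.
split=> X w; apply: half_inj.
  have := congr2 +%R (beta X w) (gamma X w); rewrite addrACA subrr addr0 => ->.
  by rewrite -addrA addKr.
have := congr2 (fun a b => a - b) (beta X w) (gamma X w).
rewrite !opprD !opprK addrACA subrr add0r => ->.
by rewrite addrC -addrA addNKr.
Qed.

(** On [J3 X = J1 (J2 X)] the map [A1] can be computed in two ways, through the
    pair of [J1] and [J2] and through the pair of [J3] and [J1], and the results
    have opposite signs. *)
Theorem quaternionic_variation_eq0 J1 J2 J3 A1 A2 A3 X w :
  quaternionic_variation J1 J2 J3 A1 A2 A3 ->
  quaternionic_variation J3 J1 J2 A3 A1 A2 -> A1 X w = 0.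
Proof.
move=> Q12 Q31; have [c12 _] := quaternionic_variation_cross Q12.
have [_ c31] := quaternionic_variation_cross Q31.
have Z z : A1 X (J3 z) = 0.
  apply: self_opp0; rewrite -c31 (qv_J12 Q12 X) (qv_qk1 Q12) c12.
  by rewrite (qv_J21 Q12) (linfN (qv_A1r Q12 X)).
by rewrite -[w]opprK -(qv_J1K Q31) Z.
Qed.
End HitchinAlgebra.

(** * The Levi-Civita connection in a chart *)

Section LocalMetric.
Variables (R : realType) (d : nat) (U : set 'rV[R]_d).
Variable g : 'rV[R]_d -> 'rV[R]_d -> 'rV[R]_d -> R.
Hypotheses (oU : open U) (g_lin : forall x u, U x -> scalar (g x u)).
Hypothesis g_sym : forall x u v, U x -> g x u v = g x v u.
Hypothesis g_pos : forall x v, U x -> v != 0 -> 0 < g x v v.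
Hypothesis g_smooth : forall u v, smooth U (fun x => g x u v).

Lemma metric_linl x v : U x -> scalar (g x ^~ v).
Proof. by move=> Ux a u w; rewrite !(g_sym _ v)// g_lin. Qed.

Lemma metric_nondeg x v : U x -> (forall w, g x w v = 0) -> v = 0.
Proof.
move=> Ux H; apply/eqP/negPn/negP => v0.
by have := g_pos Ux v0; rewrite H ltxx.
Qed.

(** Matrix form of the metric, whose inverse raises the index of the Christoffel
    symbols. *)
Definition gram x : 'M[R]_d := \matrix_(i, j) g x (delta_mx 0 i) (delta_mx 0 j).

Lemma gramE x u v : U x -> g x u v = (u *m gram x *m v^T) 0 0.
Proof.
move=> Ux; rewrite (lin_sum_delta v (g_lin u Ux)) mxE; apply: eq_bigr => j _.
rewrite !mxE mulrC; congr (_ * _).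
rewrite (lin_sum_delta u (metric_linl (delta_mx 0 j) Ux)).
by apply: eq_bigr => i _; rewrite mxE.
Qed.

Lemma gram_unit x : U x -> gram x \in unitmx.
Proof.
move=> Ux; rewrite -row_free_unit -kermx_eq0; apply/eqP/row_matrixP => i.
rewrite row0; apply: (metric_nondeg Ux) => w.
by rewrite g_sym// gramE// -row_mul mulmx_ker row0 mul0mx mxE.
Qed.

(** The Koszul formula on constant vector fields, that is, the Christoffel symbols
    of the first kind. *)
Definition koszul x u v w : R :=
  2^-1 * ('D_u (fun y => g y v w) x + 'D_v (fun y => g y u w) x
          - 'D_w (fun y => g y u v) x).

Definition christoffel x u v : 'rV[R]_d :=
  (\row_l koszul x u v (delta_mx 0 l)) *m invmx (gram x).

Let g_diff u v x : U x -> differentiable (fun y => g y u v) x.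
Proof. by move=> Ux; apply: smooth_diff (g_smooth u v) Ux. Qed.

Let Dg_linr x u v : U x -> scalar (fun w => 'D_u (fun y => g y v w) x).
Proof.
move=> Ux a w z.
have E : \forall y \near x,
    ((a \*o (fun y => g y v w)) + (fun y => g y v z)) y = g y v (a *: w + z).
  by apply: (open_near oU Ux) => y Uy; rewrite g_lin.
rewrite -(near_eq_derive _ E); have dw := diff_derivable (g_diff v w Ux).
rewrite deriveD; [|exact: derivableM (derivable_cst _ _ _) (dw _)|].
  by rewrite deriveMl.
exact: diff_derivable (g_diff v z Ux).
Qed.

Let Dg_linl x u w : U x -> scalar (fun v => 'D_u (fun y => g y v w) x).
Proof.
move=> Ux a v z.
have E v' : 'D_u (fun y => g y v' w) x = 'D_u (fun y => g y w v') x.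
  by apply: near_eq_derive; apply: (open_near oU Ux) => y; exact: g_sym.
by rewrite !E Dg_linr.
Qed.

Let D_lin (f : 'rV[R]_d -> R) x : differentiable f x ->
  scalar (fun u => 'D_u f x).
Proof. by move=> df a u v; rewrite !deriveE// linearP. Qed.

Lemma koszulC x u v w : U x -> koszul x u v w = koszul x v u w.
Proof.
move=> Ux; rewrite /koszul [X in X - _]addrC; congr (_ * (_ - _)).
by apply: near_eq_derive; apply: (open_near oU Ux) => y; exact: g_sym.
Qed.

Lemma koszul_linr x u v : U x -> scalar (koszul x u v).
Proof.
move=> Ux a w z; rewrite /koszul !Dg_linr// (D_lin (g_diff u v Ux)); ring.
Qed.

Lemma koszul_linl x v w : U x -> scalar (fun u => koszul x u v w).
Proof.
move=> Ux a u z; rewrite /koszul !Dg_linl// (D_lin (g_diff v w Ux)); ring.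
Qed.

Lemma metric_christoffel x u v w : U x ->
  g x (christoffel x u v) w = koszul x u v w.
Proof.
move=> Ux; rewrite gramE// /christoffel mulmxKV; last exact: gram_unit.
rewrite (lin_sum_delta w (koszul_linr u v Ux)) mxE; apply: eq_bigr => l _.
by rewrite !mxE mulrC.
Qed.

Lemma christoffelC x u v : U x -> christoffel x u v = christoffel x v u.
Proof.
move=> Ux; rewrite /christoffel; congr (_ *m _); apply/rowP => l.
by rewrite !mxE koszulC.
Qed.

Lemma christoffel_linl x v : U x -> linear (christoffel x ^~ v).
Proof.
move=> Ux a u w; rewrite /christoffel scalemxAl -mulmxDl; congr (_ *m _).
by apply/rowP => l; rewrite !mxE koszul_linl.
Qed.

Lemma christoffel_linr x u : U x -> linear (christoffel x u).
Proof. by move=> Ux a v w; rewrite !(christoffelC u)// christoffel_linl. Qed.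

Lemma christoffel_metric x u v w : U x ->
  'D_u (fun y => g y v w) x =
  g x (christoffel x u v) w + g x v (christoffel x u w).
Proof.
move=> Ux; rewrite (g_sym v)// !metric_christoffel// /koszul.
have -> : 'D_u (fun y => g y w v) x = 'D_u (fun y => g y v w) x.
  by apply: near_eq_derive; apply: (open_near oU Ux) => y; exact: g_sym.
by field.
Qed.

Lemma koszul_smooth u v w : smooth U (fun x => koszul x u v w).
Proof.
have D a b c := smooth_derive a (g_smooth b c).
apply: (smoothZ oU 2^-1); apply: (smoothD oU); first by apply: (smoothD oU).
apply: (eq_smooth oU) (smoothZ oU (- 1) (D w u v)) => x _.
by rewrite scaleN1r.
Qed.

Lemma gram_cofactor_smooth i j : smooth U (fun x => cofactor (gram x) i j).
Proof.
move=> k; apply: CkM => //; first exact: Ck_cst.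
apply: Ck_sum => // s; apply: CkM => //; first exact: Ck_cst.
apply: Ck_prod => // l.
by apply: eq_Ck (g_smooth _ _ k) => // x _; rewrite !mxE.
Qed.

Lemma gram_det_smooth : smooth U (fun x => \det (gram x)).
Proof.
move=> k; apply: Ck_sum => // s; apply: CkM => //; first exact: Ck_cst.
apply: Ck_prod => // l.
by apply: eq_Ck (g_smooth _ _ k) => // x _; rewrite !mxE.
Qed.

(** Smoothness of the inverse Gram matrix comes from its expression by
    cofactors. *)
Lemma christoffel_smooth u v : smooth U (fun x => christoffel x u v).
Proof.
move=> k; apply: Ck_row => // j.
have det0 x : U x -> \det (gram x) != 0.
  by move=> /gram_unit; rewrite unitmxE unitfE.
apply: (@eq_Ck _ _ _ _ _ (fun x => \sum_l koszul x u v (delta_mx 0 l) *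
   ((\det (gram x))^-1 * cofactor (gram x) j l))) => //.
  move=> x Ux; rewrite mxE; apply: eq_bigr => l _.
  by rewrite mxE /invmx gram_unit// !mxE.
apply: Ck_sum => // l; apply: CkM => //; first exact: koszul_smooth.
apply: CkM => //; last exact: gram_cofactor_smooth.
exact: (CkV oU det0 (gram_det_smooth k)).
Qed.

Lemma derive_metric X Y Z x : smooth U Y -> smooth U Z -> U x ->
  'D_X (fun y => g y (Y y) (Z y)) x =
  'D_X (fun y => g y (Y x) (Z x)) x + g x ('D_X Y x) (Z x)
  + g x (Y x) ('D_X Z x).
Proof.
move=> CY CZ Ux; have dY := smooth_diff CY Ux; have dZ := smooth_diff CZ Ux.
have HZ v := @derive_scalar_family _ _ _ _ _ _ oU Ux dZ (fun y => g y v) X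
  (fun y Uy => g_lin v Uy) (fun w => g_diff v w Ux).
have [_ ->] := @derive_scalar_family _ _ _ _ _ _ oU Ux dY
  (fun y v => g y v (Z y)) X (fun y Uy => metric_linl (Z y) Uy) (fun v => (HZ v).1).
by rewrite (HZ (Y x)).2 addrAC.
Qed.

Lemma levi_civita_christoffel : levi_civita U g christoffel.
Proof.
split.
- by move=> x u Ux; split; [exact: christoffel_linr|exact: christoffel_linl].
- exact: christoffel_smooth.
- move=> X Y CX CY x Ux; rewrite /nabla /lie_bracket (christoffelC (Y x))//.
  by rewrite opprD addrACA subrr addr0.
- move=> X Y Z CX CY CZ x Ux; rewrite derive_metric// christoffel_metric//.
  rewrite /nabla.
  rewrite (linfD (metric_linl (Z x) Ux)) (linfD (g_lin (Y x) Ux)).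
  ring.
Qed.

(** * Closed Kähler forms and parallel complex structures *)

Local Notation G := christoffel.

Record almost_hermitian (J : 'rV[R]_d -> 'rV[R]_d -> 'rV[R]_d) : Prop := {
  ah_linear : forall x, U x -> linear (J x);
  ah_smooth : forall v, smooth U (J ^~ v);
  ah_sqr : forall x v, U x -> J x (J x v) = - v;
  ah_isometry : forall x u v, U x -> g x (J x u) (J x v) = g x u v
}.

Definition kahler_form (J : 'rV[R]_d -> 'rV[R]_d -> 'rV[R]_d) x u v :=
  g x u (J x v).

(** The exterior derivative on constant vector fields, whose brackets vanish. *)
Definition closed_2form (om : 'rV[R]_d -> 'rV[R]_d -> 'rV[R]_d -> R) :=
  forall x u v w, U x ->
  'D_u (fun y => om y v w) x + 'D_v (fun y => om y w u) x
  + 'D_w (fun y => om y u v) x = 0.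

(** The covariant derivative of [J] along [u], applied to the constant field
    [w]. *)
Definition cov_endo (J : 'rV[R]_d -> 'rV[R]_d -> 'rV[R]_d) x u w : 'rV[R]_d :=
  'D_u (J ^~ w) x + G x u (J x w) - J x (G x u w).

Section OneStructure.
Variable J : 'rV[R]_d -> 'rV[R]_d -> 'rV[R]_d.
Hypothesis HJ : almost_hermitian J.
Let Jlin := ah_linear HJ.

Let dJ x v : U x -> differentiable (J ^~ v) x.
Proof. by move=> Ux; exact: smooth_diff (ah_smooth HJ v) Ux. Qed.

Lemma metric_Jl x u v : U x -> g x (J x u) v = - g x u (J x v).
Proof.
move=> Ux; rewrite -(ah_isometry HJ (J x u) v Ux) (ah_sqr HJ)//.
exact: (linfN (metric_linl _ Ux)).
Qed.

Lemma cov_endo_linl x w : U x -> linear (cov_endo J x ^~ w).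
Proof.
move=> Ux a u v; rewrite /cov_endo !christoffel_linl// Jlin// !(deriveE _ (dJ w Ux)).
rewrite linearP /= !scalerDr scalerN opprD.
by rewrite [X in X + _ = _]addrACA [LHS]addrACA.
Qed.

Lemma cov_endo_linr x u : U x -> linear (cov_endo J x u).
Proof.
move=> Ux a v w; rewrite /cov_endo !Jlin// !christoffel_linr// Jlin//.
have -> : 'D_u (J^~ (a *: v + w)) x = a *: 'D_u (J^~ v) x + 'D_u (J^~ w) x.
  have E : \forall y \near x, ((a \*: (J^~ v)) + J^~ w) y = J y (a *: v + w).
    by apply: (open_near oU Ux) => y Uy; rewrite Jlin.
  have dv := diff_derivable (dJ v Ux); have dw := diff_derivable (dJ w Ux).
  rewrite -(near_eq_derive _ E) deriveD; [|exact: derivableZ (dv _)|exact: dw].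
  by rewrite deriveZ.
by rewrite !scalerDr scalerN opprD [X in X + _ = _]addrACA [LHS]addrACA.
Qed.

Lemma cov_endo_anti x u w : U x ->
  cov_endo J x u (J x w) = - J x (cov_endo J x u w).
Proof.
move=> Ux; rewrite /cov_endo (linfB (Jlin Ux)) (linfD (Jlin Ux)) !(ah_sqr HJ)//.
have [_] := derive_linear_family oU Ux (dJ w Ux) (L := J) u Jlin
  (fun v => dJ v Ux).
have E : \forall y \near x, cst (- w) y = J y (J y w).
  by apply: (open_near oU Ux) => y Uy; rewrite (ah_sqr HJ).
rewrite -(near_eq_derive _ E) derive_cst => /esym/eqP.
rewrite addr_eq0 => /eqP ->.
by rewrite (linfN (christoffel_linr u Ux)) opprK !opprD addrAC.
Qed.

Lemma nabla_cov_endo X Y x : smooth U X -> smooth U Y -> U x ->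
  nabla G X (fun y => J y (Y y)) x =
  J x (nabla G X Y x) + cov_endo J x (X x) (Y x).
Proof.
move=> CX CY Ux; rewrite /nabla /cov_endo.
have [_ ->] := derive_linear_family oU Ux (smooth_diff CY Ux) (L := J) (X x) Jlin
  (fun v => dJ v Ux).
by rewrite (linfD (Jlin Ux)) [RHS]addrACA subrr addr0 addrAC addrC.
Qed.

(** As the metric is parallel, only the derivative of [J] contributes besides the
    two Christoffel terms. *)
Lemma derive_kahler_form x u v w : U x ->
  'D_u (fun y => kahler_form J y v w) x =
  g x v (cov_endo J x u w) + kahler_form J x (G x u v) w
  + kahler_form J x v (G x u w).
Proof.
move=> Ux; rewrite /kahler_form /cov_endo.
have dg a b : differentiable (fun y => g y a b) x.
  exact: smooth_diff (g_smooth a b) Ux.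
have [_ ->] := @derive_scalar_family _ _ _ _ _ _ oU Ux (dJ w Ux)
  (fun y => g y v) u (fun y Uy => g_lin v Uy) (dg v).
rewrite christoffel_metric// (linfB (g_lin v Ux)) (linfD (g_lin v Ux)).
ring.
Qed.

Lemma kahler_formN x u v : U x -> kahler_form J x u v = - kahler_form J x v u.
Proof. by move=> Ux; rewrite /kahler_form g_sym// metric_Jl. Qed.

(** An almost Kähler structure is quasi-Kähler. In the cyclic sums of
    [a X Y Z = g Y ((nabla_X J) Z)] the Christoffel terms cancel, because the
    connection is torsion free, so that these sums vanish; the sum for
    [(u, Y, Z)] minus that for [(u, J Y, J Z)] plus those for [(J u, J Y, Z)] and
    [(J u, Y, J Z)] leaves twice [a u Y Z + a (J u) (J Y) Z]. *)
Lemma closed_quasi_kahler : closed_2form (kahler_form J) ->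
  forall x u w, U x -> cov_endo J x (J x u) w = cov_endo J x u (J x w).
Proof.
move=> closedJ x u w Ux.
pose a X Y Z := g x Y (cov_endo J x X Z).
have cyc X Y Z : a X Y Z + a Y Z X + a Z X Y = 0.
  have := closedJ x X Y Z Ux; rewrite !derive_kahler_form// -/(a X Y Z).
  rewrite -/(a Y Z X) -/(a Z X Y) (kahler_formN (G x X Y))//.
  rewrite (kahler_formN (G x Y Z))// (kahler_formN (G x Z X))//.
  rewrite (christoffelC Y X)// (christoffelC Z Y)//.
  rewrite (christoffelC X Z)//.
  move: (a _ _ _) (a _ _ _) (a _ _ _) (kahler_form _ _ _ _).
  move: (kahler_form _ _ _ _) (kahler_form _ _ _ _).
  by move=> *; lra.
have aJ X Y Z : a X (J x Y) Z = a X Y (J x Z).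
  rewrite /a metric_Jl// cov_endo_anti//.
  by rewrite (linfN (g_lin _ Ux)).
have aJJ X Y Z : a X (J x Y) (J x Z) = - a X Y Z.
  rewrite aJ (ah_sqr HJ)// /a (linfN (cov_endo_linr X Ux)).
  by rewrite (linfN (g_lin _ Ux)).
have key Y Z : a (J x u) (J x Y) Z = - a u Y Z.
  have := cyc u Y Z; have := cyc u (J x Y) (J x Z).
  have := cyc (J x u) (J x Y) Z; have := cyc (J x u) Y (J x Z).
  rewrite !aJJ !aJ; clearbody a; lra.
have E Z : cov_endo J x (J x u) (J x Z) = - cov_endo J x u Z.
  apply/eqP; rewrite -addr_eq0; apply/eqP.
  apply: (metric_nondeg Ux) => Y; rewrite (linfD (g_lin Y Ux)).
  have k : a (J x u) Y (J x Z) = - a u Y Z.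
    exact: eq_trans (esym (aJ (J x u) Y Z)) (key Y Z).
  exact: (eq_trans (congr1 (+%R^~ (a u Y Z)) k) (addNr (a u Y Z))).
apply: oppr_inj; apply: eq_trans (E (J x w)); rewrite (ah_sqr HJ w Ux).
exact: esym (linfN (cov_endo_linr (J x u) Ux) w).
Qed.
End OneStructure.

Lemma cov_endo_comp J1 J2 J3 : almost_hermitian J1 -> almost_hermitian J2 ->
  (forall y v, U y -> J3 y v = J1 y (J2 y v)) -> forall x u w, U x ->
  cov_endo J3 x u w = cov_endo J1 x u (J2 x w) + J1 x (cov_endo J2 x u w).
Proof.
move=> H1 H2 E3 x u w Ux; rewrite /cov_endo.
have d1 v : differentiable (J1 ^~ v) x.
  exact: smooth_diff (ah_smooth H1 v) Ux.
have d2 : differentiable (J2 ^~ w) x.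
  exact: smooth_diff (ah_smooth H2 w) Ux.
have E : \forall y \near x, J1 y (J2 y w) = J3 y w.
  by apply: (open_near oU Ux) => y Uy; rewrite E3.
have [_ D] := derive_linear_family oU Ux d2 (L := J1) u (ah_linear H1) d1.
rewrite -(near_eq_derive _ E) D !E3//.
rewrite (linfB (ah_linear H1 Ux)) (linfD (ah_linear H1 Ux)).
rewrite [X in _ = _ + (X - _)]addrC -!addrA addKr; congr (_ + _).
exact: addrCA.
Qed.

(** Hitchin's lemma: closedness of the three Kähler forms suffices for an almost
    hyperhermitian structure to be hyperkähler. *)
Theorem closed_kahler_forms_parallel (J : 'I_3 -> 'rV[R]_d -> 'rV[R]_d -> 'rV[R]_d) :
  (forall i, almost_hermitian (J i)) ->
  (forall i, closed_2form (kahler_form (J i))) ->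
  for_even_perm (fun i j k => forall x v, U x ->
    J i x (J j x v) = J k x v /\ J j x (J i x v) = - J k x v) ->
  forall i X Y, smooth U X -> smooth U Y -> forall x, U x ->
  nabla G X (fun y => J i y (Y y)) x = J i x (nabla G X Y x).
Proof.
move=> HJ cJ HQ.
(* The hypothesis is a universally quantified relation of the three structures,
   since its derivative is used as well as its value at x. *)
have variation i j k x : U x ->
    (forall x v, U x -> J i x (J j x v) = J k x v /\
                        J j x (J i x v) = - J k x v) ->
    quaternionic_variation (J i x) (J j x) (J k x)
      (cov_endo (J i) x) (cov_endo (J j) x) (cov_endo (J k) x).
  move=> Ux H; split.
  - exact: (ah_linear (HJ i) Ux).
  - exact: (ah_linear (HJ j) Ux).
  - by move=> w; exact: (cov_endo_linl (HJ i) w Ux).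
  - by move=> w; exact: (cov_endo_linr (HJ i) w Ux).
  - by move=> w; exact: (cov_endo_linl (HJ j) w Ux).
  - by move=> w; exact: (cov_endo_linr (HJ j) w Ux).
  - by move=> w; exact: (ah_sqr (HJ i) w Ux).
  - by move=> w; exact: (ah_sqr (HJ j) w Ux).
  - by move=> w; have [-> _] := H x w Ux.
  - by move=> w; have [_ ->] := H x w Ux; rewrite opprK.
  - move=> u w; apply: (cov_endo_comp (HJ i) (HJ j) _ u w Ux) => y v Uy.
    by have [->] := H y v Uy.
  - by move=> u w; exact: (cov_endo_anti (HJ i) u w Ux).
  - by move=> u w; exact: (closed_quasi_kahler (HJ i) (cJ i) u w Ux).
  - by move=> u w; exact: (closed_quasi_kahler (HJ j) (cJ j) u w Ux).
  - by move=> u w; exact: (closed_quasi_kahler (HJ k) (cJ k) u w Ux).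
move=> i X Y CX CY x Ux; have [j [k [cyc _]]] := even_perm_completion i.
have [ijk jki kij] := cyc _ HQ.
rewrite (nabla_cov_endo (HJ i))//.
have -> : cov_endo (J i) x (X x) (Y x) = 0.
  exact: (quaternionic_variation_eq0 (X x) (Y x)
            (variation i j k x Ux ijk) (variation k i j x Ux kij)).
by rewrite addr0.
Qed.
End LocalMetric.

(* From here on coord is a chart map again, not a coordinate in a basis. *)
Import Defs.

(** * Differentials in charts *)

Section Charts.
Variable R : realType.

Lemma cimg_param m (M : manifold R m) (c : atlas M) x : cimg c x ->
  cdom c (param c x) /\ coord c (param c x) = x.
Proof. by case=> p cp <-; rewrite coordK. Qed.

Lemma coord_cimg m (M : manifold R m) (c : atlas M) p : cdom c p ->
  cimg c (coord c p).
Proof. by move=> cp; exists p. Qed.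

Lemma coord_open_image m (M : manifold R m) (c : atlas M) (E : set M) :
  open E -> open (coord c @` (cdom c `&` E)).
Proof.
move=> oE; rewrite openE => x [p [cp Ep] <-{x}].
have cx := coord_cimg cp.
have n1 : nbhs (coord c p) (cimg c).
  by apply: open_nbhs_nbhs; split => //; exact: cimg_open.
have n2 : nbhs (coord c p) (param c @^-1` E).
  apply: (param_continuous cx); rewrite coordK//.
  by apply: open_nbhs_nbhs; split.
apply: filterS (filterI n1 n2) => y [/= cy Ey].
by have [cpy yE] := cimg_param cy; exists (param c y).
Qed.

Section Chain.
Variables (m1 m2 m3 : nat).
Variables (A : manifold R m1) (B : manifold R m2) (C : manifold R m3).
Variables (h : A -> B) (k : B -> C) (a : atlas A) (b : atlas B) (c : atlas C).
Variable p : A.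
Hypotheses (ap : cdom a p) (bp : cdom b (h p)).
Hypothesis hc : {for p, continuous h}.
Hypothesis dh : differentiable (in_charts h a b) (coord a p).
Hypothesis dk : differentiable (in_charts k b c) (coord b (h p)).

Lemma in_charts_point : in_charts h a b (coord a p) = coord b (h p).
Proof. by rewrite /in_charts /= coordK. Qed.

(** Functoriality of the differential. Changes of charts are the case of the
    identity map, since [dtrans] is its differential. *)
Lemma dmap_comp v : dmap (k \o h) a c p v = dmap k b c (h p) (dmap h a b p v).
Proof.
have dk' : differentiable (in_charts k b c) (in_charts h a b (coord a p)).
  by rewrite in_charts_point.
have E : \forall x \near coord a p,
    (in_charts k b c \o in_charts h a b) x = in_charts (k \o h) a c x.
  have n : nbhs (coord a p) ((h \o param a) @^-1` cdom b).
    apply: (@continuous_comp _ _ _ (param a) h).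
    - exact: param_continuous (coord_cimg ap).
    - by rewrite coordK.
    - rewrite /= coordK//; apply: open_nbhs_nbhs; split => //.
      exact: cdom_open.
  by apply: filterS n => x /= bx; rewrite /in_charts /= coordK.
rewrite /dmap (near_eq_diff E); last exact: differentiable_comp dh dk'.
by rewrite (diff_comp dh dk') /= in_charts_point.
Qed.
End Chain.

Lemma differentiable_transition m (M : manifold R m) (c c' : atlas M) p :
  cdom c p -> cdom c' p ->
  differentiable (in_charts (@id M) c c') (coord c p).
Proof.
move=> cp c'p; have [df _] := @transition_smooth _ _ M c c' 1%N.
by apply: df; exists p.
Qed.

Lemma differentiable_in_charts m d (M : manifold R m) (N : manifold R d)
    (U : set M) (f : M -> N) c c' p : smooth_map U f ->
  cdom c p -> U p -> cdom c' (f p) ->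
  differentiable (in_charts f c c') (coord c p).
Proof.
move=> [_ Cf] cp Up c'p; have [df _] := Cf c c' 1%N.
by apply: df; exists p.
Qed.

Lemma dmap_id m (M : manifold R m) (c : atlas M) p v : cdom c p ->
  dmap (@id M) c c p v = v.
Proof.
move=> cp; have E : \forall x \near coord c p, id x = in_charts (@id M) c c x.
  have n : nbhs (coord c p) (cimg c).
    apply: open_nbhs_nbhs; split; [exact: cimg_open|exact: coord_cimg].
  by apply: filterS n => x /cimg_param[_ xE]; rewrite /in_charts /= xE.
by rewrite /dmap (near_eq_diff E)// diff_val.
Qed.
End Charts.

(** * Linear algebra of an almost 3-contact submersion *)

Section AlmostContactAlgebra.
Variables (R : realType) (V W : lmodType R).
Variables (xi : 'I_3 -> V) (eta : 'I_3 -> V -> R) (phi : 'I_3 -> V -> V).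
Variables (g : V -> V -> R) (gN : W -> W -> R) (df : V -> W) (ds : W -> V).
Hypotheses (phi_lin : forall i, linear (phi i)).
Hypotheses (g_linl : forall v, linear (g ^~ v : V -> R^o)).
Hypotheses (g_linr : forall v, linear (g v : V -> R^o)).
Hypotheses (df_lin : linear df).
Hypothesis acm : forall i,
  [/\ forall v, phi i (phi i v) = - v + eta i v *: xi i,
      eta i (xi i) = 1,
      phi i (xi i) = 0,
      forall v, eta i (phi i v) = 0
    & forall u v, g (phi i u) (phi i v) = g u v - eta i u * eta i v].
Hypothesis a3c : for_even_perm (fun i j k =>
    [/\ forall v, phi k v = phi i (phi j v) - eta j v *: xi i,
        forall v, phi k v = - phi j (phi i v) + eta i v *: xi j,
        xi k = phi i (xi j) /\ xi k = - phi j (xi i),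
        forall v, eta k v = eta i (phi j v)
      & forall v, eta k v = - eta j (phi i v)]).
Hypothesis df_ds : forall v, df (ds v) = v.
Hypothesis df_ker : forall v, df v = 0 <-> exists a, v = \sum_i a i *: xi i.
Hypothesis df_iso : forall u v,
  (forall w, df w = 0 -> g w u = 0) -> (forall w, df w = 0 -> g w v = 0) ->
  gN (df u) (df v) = g u v.

Definition horizontal_part v := v - \sum_l eta l v *: xi l.
(** The induced structure uses the value [ds v] of the section rather than the
    horizontal lift of [v]: the two differ by a vertical vector, which [phi i] maps
    to a vertical vector. *)
Definition base_endo i v := df (phi i (ds v)).

Lemma g_xi i v : g v (xi i) = eta i v.
Proof.
have [_ e1 p0 _ gp] := acm i; have := gp v (xi i).
by rewrite p0 e1 mulr1 (linf0 (g_linr _)) => /esym/eqP; rewrite subr_eq0 => /eqP.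
Qed.

Lemma g_xil i v : g (xi i) v = eta i v.
Proof.
have [_ e1 p0 _ gp] := acm i; have := gp (xi i) v.
rewrite p0 e1 mul1r (linf0 (g_linl _)) => /esym/eqP.
by rewrite subr_eq0 => /eqP.
Qed.

Lemma eta_xi i l : eta i (xi l) = (i == l)%:R.
Proof.
have [_ e1 _ _ _] := acm i.
have [j [k [cyc E]]] := even_perm_completion i.
have [_ [_ _ _ H1 H2] _] := cyc _ a3c.
have ij : eta i (xi j) = 0.
  by rewrite H2; have [_ _ -> _ _] := acm j; rewrite -g_xi (linf0 (g_linl _)) oppr0.
have ik : eta i (xi k) = 0.
  by rewrite H1; have [_ _ -> _ _] := acm k; rewrite -g_xi (linf0 (g_linl _)).
case: eqVneq => [<-|il]; first by rewrite e1.
have := E R^o (fun h => (h == l)%:R * eta i (xi h)).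
rewrite ij ik !mulr0 !addr0 (negPf il) mul0r (bigD1 l)//= eqxx mul1r.
by rewrite big1 ?addr0// => h /negPf ->; rewrite mul0r.
Qed.

Lemma df_xi l : df (xi l) = 0.
Proof.
apply/df_ker; exists (fun i => (i == l)%:R).
rewrite (bigD1 l)//= eqxx scale1r big1 ?addr0// => i /negPf ->.
by rewrite scale0r.
Qed.

Lemma df_horizontal v : df (horizontal_part v) = df v.
Proof.
rewrite /horizontal_part (linfB df_lin).
have -> : df (\sum_l eta l v *: xi l) = 0 by apply/df_ker; exists (eta ^~ v).
by rewrite subr0.
Qed.

Lemma g_sumr u (a : 'I_3 -> R) :
  g u (\sum_l a l *: xi l) = \sum_l a l * eta l u.
Proof.
elim/big_ind2: _ => [|x p y q Ex Ey|l _]; first exact: (linf0 (g_linr u)).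
  by rewrite (linfD (g_linr u)) Ex Ey.
by rewrite (linfZ (g_linr u)) g_xi.
Qed.

Lemma g_suml u (a : 'I_3 -> R) :
  g (\sum_l a l *: xi l) u = \sum_l a l * eta l u.
Proof.
elim/big_ind2: _ => [|x p y q Ex Ey|l _]; first exact: (linf0 (g_linl u)).
  by rewrite (linfD (g_linl u)) Ex Ey.
by rewrite (linfZ (g_linl u)) g_xil.
Qed.

Lemma eta_horizontal l v : eta l (horizontal_part v) = 0.
Proof.
rewrite -g_xil /horizontal_part (linfB (g_linr _)) g_xil g_sumr.
rewrite (bigD1 l)//= eta_xi eqxx mulr1 big1 ?addr0 ?subrr// => h hl.
by rewrite eta_xi (negPf hl) mulr0.
Qed.

(** Both vectors are projected to their horizontal parts, on which the submersion
    is isometric. *)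
Lemma df_metric u v :
  gN (df u) (df v) = g u v - \sum_l eta l u * eta l v.
Proof.
rewrite -(df_horizontal u) -(df_horizontal v) df_iso.
- rewrite {2}/horizontal_part (linfB (g_linr _)) g_sumr.
  rewrite [X in _ - X]big1 ?subr0.
    rewrite /horizontal_part (linfB (g_linl _)) g_suml.
    by [].
  by move=> l _; rewrite eta_horizontal mulr0.
- move=> w /df_ker[a ->]; rewrite g_suml big1// => l _.
  by rewrite eta_horizontal mulr0.
- move=> w /df_ker[a ->]; rewrite g_suml big1// => l _.
  by rewrite eta_horizontal mulr0.
Qed.

Lemma df_phi_xi i l : df (phi i (xi l)) = 0.
Proof.
have [_ _ p0 _ _] := acm i.
have [j [k [cyc E]]] := even_perm_completion i.
have [[_ _ [xk _] _ _] _ [_ _ [_ xj] _ _]] := cyc _ a3c.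
have pj : df (phi i (xi j)) = 0 by rewrite -xk df_xi.
have pk : df (phi i (xi k)) = 0.
  by rewrite -[phi i _]opprK -xj (linfN df_lin) df_xi oppr0.
have := E W (fun h => (h == l)%:R *: df (phi i (xi h))).
rewrite p0 (linf0 df_lin) pj pk !scaler0 !addr0.
rewrite (bigD1 l)//= eqxx scale1r big1 ?addr0// => h /negPf ->.
by rewrite scale0r.
Qed.

(** The mechanism behind all identities for the induced structures: up to vertical
    vectors, [ds] inverts [df], and [phi i] preserves vertical vectors. *)
Lemma df_phi_ds i v : df (phi i (ds (df v))) = df (phi i v).
Proof.
apply/eqP; rewrite -subr_eq0 -(linfB df_lin) -(linfB (phi_lin i)); apply/eqP.
have /df_ker[a ->] : df (ds (df v) - v) = 0.
  by rewrite (linfB df_lin) df_ds subrr.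
elim/big_rec: _ => [|l w _ IH]; first by rewrite (linf0 (phi_lin i)) linf0.
rewrite (linfD (phi_lin i)) (linfD df_lin) IH addr0 (linfZ (phi_lin i)).
by rewrite (linfZ df_lin) df_phi_xi scaler0.
Qed.

Lemma base_endo_sqr i v : base_endo i (base_endo i v) = - v.
Proof.
rewrite /base_endo df_phi_ds; have [-> _ _ _ _] := acm i.
rewrite (linfD df_lin) (linfN df_lin) df_ds (linfZ df_lin) df_xi scaler0.
by rewrite addr0.
Qed.

Lemma base_endo_quaternion : for_even_perm (fun i j k => forall v,
  base_endo i (base_endo j v) = base_endo k v /\
  base_endo j (base_endo i v) = - base_endo k v).
Proof.
move=> s es; have [H1 H2 _ _ _] := a3c es => v; rewrite /base_endo !df_phi_ds.
split; first by rewrite H1 (linfB df_lin) (linfZ df_lin) df_xi scaler0 subr0.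
rewrite H2 (linfD df_lin) (linfN df_lin) (linfZ df_lin) df_xi scaler0 addr0.
by rewrite opprK.
Qed.

Lemma base_endo_isometry i u v : gN (base_endo i u) (base_endo i v) = gN u v.
Proof.
have [j [k [cyc E]]] := even_perm_completion i.
have [[_ _ _ ek ek'] [_ _ _ ei ei'] [_ _ _ ej ej']] := cyc _ a3c.
have [_ _ _ ep gp] := acm i.
have -> : gN u v = gN (df (ds u)) (df (ds v)) by rewrite !df_ds.
rewrite /base_endo !df_metric.
rewrite (E R^o (fun l => eta l (phi i (ds u)) * eta l (phi i (ds v)))).
rewrite (E R^o (fun l => eta l (ds u) * eta l (ds v))) gp !ep.
rewrite (ej (ds u)) (ej (ds v)) (ek' (ds u)) (ek' (ds v)).
ring.
Qed.

(** The right-hand side is the horizontal part of the fundamental form; the wedge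
    product removes its value [- eta j /\ eta k] on vertical vectors. *)
Lemma base_kahler_form i j k u v :
  (forall P, for_even_perm P -> [/\ P i j k, P j k i & P k i j]) ->
  (forall (V : zmodType) (F : 'I_3 -> V), \sum_l F l = F i + F j + F k) ->
  gN u (base_endo i v) =
  g (ds u) (phi i (ds v)) + (eta j (ds u) * eta k (ds v) -
                             eta j (ds v) * eta k (ds u)).
Proof.
move=> cyc E.
have [[_ _ _ ek ek'] [_ _ _ ei ei'] [_ _ _ ej ej']] := cyc _ a3c.
have [_ _ _ ep gp] := acm i.
rewrite -{1}(df_ds u) /base_endo df_metric.
rewrite (E R^o (fun l => eta l (ds u) * eta l (phi i (ds v)))) ep.
rewrite (ej (ds v)) (ek' (ds v)).
ring.
Qed.
End AlmostContactAlgebra.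

(** * The hyperkähler structure of the base *)

Section BaseStructure.
Variables (R : realType) (n : nat) (M : manifold R (4 * n + 3)).
Variables (phi : 'I_3 -> endo_field M) (xi : 'I_3 -> vector_field M).
Variables (eta : 'I_3 -> one_form M) (g : riemannian_metric M) (alpha : R).
Hypothesis HM : sasaki_3_alpha_delta phi xi eta g alpha 0.
Variables (d : nat) (N : manifold R d) (gN : riemannian_metric N).
Variables (U : set M) (f : M -> N) (s : N -> M).
Hypotheses (Hf : canonical_submersion xi g gN U f) (Hs : smooth_section U f s).

Let f_smooth : smooth_map U f. Proof. by case: Hf => _ []. Qed.
Let oU : open U. Proof. by case: Hf. Qed.
Let s_smooth : smooth_map setT s. Proof. by case: Hs. Qed.
Let Us p : U (s p). Proof. by case: Hs => _ /(_ p)[]. Qed.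
Let fs p : f (s p) = p. Proof. by case: Hs => _ /(_ p)[]. Qed.
Let s_cont p : {for p, continuous s}. Proof. by case: s_smooth => H _; exact: H. Qed.
Let f_cont p : U p -> {for p, continuous f}.
Proof. by case: f_smooth => H _; exact: H. Qed.

(** The endomorphism [pi_* phi_i s_*] of the tangent space at [p], computed in a
    chart [b] around [s p]. *)
Definition base_J i (c : atlas N) (b : atlas M) (p : N) (v : 'rV[R]_d) :=
  dmap f b c (s p) (phi i b (coord b (s p)) (dmap s c b p v)).

Let diff_s c b p : cdom c p -> cdom b (s p) ->
  differentiable (in_charts s c b) (coord c p).
Proof. by move=> cp bp; exact: (differentiable_in_charts s_smooth cp I bp). Qed.

Let diff_f c b p : cdom c p -> cdom b (s p) ->
  differentiable (in_charts f b c) (coord b (s p)).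
Proof.
move=> cp bp; apply: (differentiable_in_charts f_smooth bp (Us p)).
by rewrite fs.
Qed.

Lemma base_J_trans i c c' b b' p v :
  cdom c p -> cdom c' p -> cdom b (s p) -> cdom b' (s p) ->
  base_J i c' b' p (dtrans c c' p v) = dtrans c c' p (base_J i c b p v).
Proof.
move=> cp c'p bq b'q; rewrite /base_J.
have idc (T : topologicalType) (q : T) : {for q, continuous (@id T)}.
  by move=> A; apply.
have -> : dmap s c' b' p (dtrans c c' p v) =
          dtrans b b' (s p) (dmap s c b p v).
  have E1 := @dmap_comp R _ _ _ N N M id s c c' b' p cp c'p (idc _ _)
    (differentiable_transition cp c'p) (diff_s c'p b'q) v.
  have E2 := @dmap_comp R _ _ _ N M M s id c b b' p cp bq (s_cont (p := p))
    (diff_s cp bq) (differentiable_transition bq b'q) v.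
  exact: (eq_trans (esym E1) E2).
rewrite (ef_trans (phi i) _ bq b'q).
set w := phi i b _ _.
have E1 := @dmap_comp R _ _ _ M M N id f b b' c' (s p) bq b'q (idc _ _)
    (differentiable_transition bq b'q) (diff_f c'p b'q) w.
have cq : cdom c (f (s p)) by rewrite fs.
have E2 := @dmap_comp R _ _ _ M N N f id b c c' (s p) bq cq (f_cont (Us p))
    (diff_f cp bq) (differentiable_transition cq (eq_ind_r (cdom c') c'p (fs p))) w.
rewrite -[LHS]/(dmap f b' c' (s p) (dmap id b b' (s p) w)) -E1.
by move: E2; rewrite [X in dmap id c c' X]fs.
Qed.

(** The case [c = c'] of the transformation rule. *)
Lemma base_J_chart i c b b' p v : cdom c p -> cdom b (s p) -> cdom b' (s p) ->
  base_J i c b p v = base_J i c b' p v.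
Proof.
move=> cp bp b'p; have := base_J_trans i v cp cp b'p bp.
by rewrite -[dtrans c c p v]/(dmap id c c p v) -[dtrans c c p _]/(dmap id c c p _)
  !dmap_id.
Qed.
Section AtPoint.
Variables (c : atlas N) (b : atlas M) (p : N).
Hypotheses (cp : cdom c p) (bp : cdom b (s p)).
Let df := dmap f b c (s p).
Let ds := dmap s c b p.
Let y := coord b (s p).
Let yb : cimg b y. Proof. exact: coord_cimg. Qed.
Let cfp : cdom c (f (s p)). Proof. by rewrite fs. Qed.
Let phi_lin i : linear (phi i b y). Proof. exact: ef_linear. Qed.
Let g_linr v : linear (g b y v : 'rV[R]_(4 * n + 3) -> R^o).
Proof. exact: rm_linear. Qed.
Let g_linl v : linear (g b y ^~ v : 'rV[R]_(4 * n + 3) -> R^o).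
Proof. by move=> a u w; rewrite !(rm_sym _ _ v)//; exact: g_linr. Qed.
Let df_lin : linear df. Proof. exact: linearP. Qed.
Let acm i :
  [/\ forall v, phi i b y (phi i b y v) = - v + eta i b y v *: xi i b y,
      eta i b y (xi i b y) = 1,
      phi i b y (xi i b y) = 0,
      forall v, eta i b y (phi i b y v) = 0
    & forall u v, g b y (phi i b y u) (phi i b y v) =
                  g b y u v - eta i b y u * eta i b y v].
Proof. by have [[H _] _ _] := HM; exact: H. Qed.
Let a3c : for_even_perm (fun i j k =>
    [/\ forall v, phi k b y v = phi i b y (phi j b y v) - eta j b y v *: xi i b y,
        forall v, phi k b y v =
          - phi j b y (phi i b y v) + eta i b y v *: xi j b y,
        xi k b y = phi i b y (xi j b y) /\ xi k b y = - phi j b y (xi i b y),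
        forall v, eta k b y v = eta i b y (phi j b y v)
      & forall v, eta k b y v = - eta j b y (phi i b y v)]).
Proof. by have [[_ H] _ _] := HM; move=> t et; exact: (H t et b y yb). Qed.
Let df_ds v : df (ds v) = v.
Proof.
rewrite /df /ds -(@dmap_comp R _ _ _ N M N s f c b c p cp bp (s_cont (p := p))
  (diff_s cp bp) (diff_f cp bp) v).
have -> : f \o s = id by apply/funext => q; exact: fs.
exact: dmap_id.
Qed.
Let df_ker v : df v = 0 <-> exists a : 'I_3 -> R, v = \sum_i a i *: xi i b y.
Proof. by case: Hf => _ _ _ H; exact: H. Qed.
Let df_iso u v :
  (forall w, df w = 0 -> g b y w u = 0) -> (forall w, df w = 0 -> g b y w v = 0) ->
  gN c (coord c p) (df u) (df v) = g b y u v.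
Proof.
case: Hf => _ [_ H] _ _; have [_ H'] := H b c (s p) bp (Us p) cfp.
by move=> hu hv; rewrite -(H' u v hu hv) fs.
Qed.

Lemma base_J_sqr i v : base_J i c b p (base_J i c b p v) = - v.
Proof.
exact: (base_endo_sqr phi_lin df_lin acm a3c df_ds df_ker).
Qed.

Lemma base_J_isometry i u v :
  gN c (coord c p) (base_J i c b p u) (base_J i c b p v) = gN c (coord c p) u v.
Proof.
exact: (base_endo_isometry g_linl g_linr df_lin acm a3c df_ds df_ker df_iso).
Qed.

Lemma base_J_quaternion : for_even_perm (fun i j k => forall v,
  base_J i c b p (base_J j c b p v) = base_J k c b p v /\
  base_J j c b p (base_J i c b p v) = - base_J k c b p v).
Proof.
exact: (base_endo_quaternion phi_lin df_lin acm a3c df_ds df_ker).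
Qed.

Lemma base_J_linear i : linear (base_J i c b p).
Proof.
move=> a u v; rewrite /base_J -/df -/ds -/y.
have dsl : linear ds by exact: linearP.
by rewrite dsl phi_lin df_lin.
Qed.

(** With [delta = 0] the structure equation reads
    [d eta_i = 2 alpha (Phi_i + eta_j /\ eta_k)], which is [2 alpha] times the
    horizontal part of [Phi_i], that is, the Kähler form of the base. Hence this
    form is, up to the factor, the pullback of [d eta_i] by the section. *)
Lemma base_J_form i u v :
  2 * alpha * gN c (coord c p) u (base_J i c b p v) =
  'D_(ds u) (fun z => eta i b z (ds v)) y
  - 'D_(ds v) (fun z => eta i b z (ds u)) y.
Proof.
have [j [k [cyc E]]] := even_perm_completion i.
have := base_kahler_form g_linl g_linr df_lin acm a3c df_ds df_ker df_iso
  (i := i) (j := j) (k := k) u v cyc E.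
rewrite -/(base_J i c b p v) => ->.
have [_ _ /cyc[H _ _]] := HM.
have Cc (w : 'rV[R]_(4 * n + 3)) : smooth (cimg b) (fun=> w).
  exact: smooth_cst.
have := H b (fun=> ds u) (fun=> ds v) (Cc _) (Cc _) y yb.
rewrite /ext_deriv /lie_bracket !derive_cst subrr.
rewrite (linf0 (of1_linear (eta i) yb : linear (eta i b y : _ -> R^o))) !subr0 => ->.
by rewrite /fundamental_form /wedge mulrDr.
Qed.
End AtPoint.

Section LocalChart.
Variables (c : atlas N) (b : atlas M).

(** The part of the chart [c] whose points are sent to the chart [b] by the
    section; the extra [setT] matches the shape of [smooth_map setT s]. *)
Definition section_dom : set 'rV[R]_d :=
  coord c @` (cdom c `&` (setT `&` s @^-1` cdom b)).
Definition submersion_dom : set 'rV[R]_(4 * n + 3) :=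
  coord b @` (cdom b `&` (U `&` f @^-1` cdom c)).

Lemma section_dom_open : open section_dom.
Proof.
apply: coord_open_image; rewrite setTI.
by apply: open_comp; [move=> p _; exact: s_cont|exact: cdom_open].
Qed.

Lemma submersion_dom_open : open submersion_dom.
Proof.
apply: coord_open_image; rewrite openE => q [Uq cq].
have n1 : nbhs q U by apply: open_nbhs_nbhs.
have n2 : nbhs q (f @^-1` cdom c).
  by apply: (f_cont Uq); apply: open_nbhs_nbhs; split => //; exact: cdom_open.
exact: filterI n1 n2.
Qed.

Let V := section_dom.
Let oV : open V. Proof. exact: section_dom_open. Qed.
Let sigma := in_charts s c b.

Lemma section_domP x : V x ->
  [/\ cimg c x, cdom c (param c x) & cdom b (s (param c x))].
Proof.
move=> [p [cp [_ bp]] <-]; split; first exact: coord_cimg.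
  by rewrite coordK.
by rewrite coordK.
Qed.

Lemma section_in_submersion_dom x : V x -> submersion_dom (sigma x).
Proof.
move=> /section_domP[_ cx bx]; exists (s (param c x)) => //.
by split=> //; split; [exact: Us|rewrite /= fs].
Qed.

Lemma sigma_smooth : smooth V sigma.
Proof.
have [_ Cs] := s_smooth; have := Cs c b.
by rewrite /V /section_dom setIA.
Qed.

Lemma base_J_smooth i v : smooth V (fun x => base_J i c b (param c x) v).
Proof.
have Cpi : smooth submersion_dom (in_charts f b c).
  have [_ Cf] := f_smooth; have := Cf b c.
  by rewrite /submersion_dom setIA.
have dpi x : V x -> differentiable (in_charts f b c) (sigma x).
  by move=> /section_in_submersion_dom Wx; exact: smooth_diff Cpi Wx.
have Csv : smooth V (fun x => 'D_v sigma x).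
  exact: smooth_derive sigma_smooth.
have sb x : V x -> cimg b (sigma x).
  by move=> /section_domP[_ _ bx]; exact: coord_cimg.
have Cphi : smooth V (fun x => phi i b (sigma x) ('D_v sigma x)).
  apply: (smooth_linear_family oV (L := fun x => phi i b (sigma x))) => //.
    by move=> x Vx; apply: ef_linear; exact: sb.
  move=> w; apply: (smooth_comp oV _ sb (@ef_smooth _ _ _ (phi i) b w)).
    exact: cimg_open.
  exact: sigma_smooth.
apply: (eq_smooth oV) (smooth_linear_family oV
  (L := fun x => 'd (in_charts f b c) (sigma x)) _ _ Cphi).
- move=> x Vx; rewrite /base_J /dmap; have [cx _ _] := section_domP Vx.
  have [_ xE] := cimg_param cx.
  rewrite xE deriveE//; exact: smooth_diff sigma_smooth Vx.
- by move=> x _; exact: linearP.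
- move=> w; apply: (@eq_smooth _ _ _ oV _
    (fun x => 'D_w (in_charts f b c) (sigma x))).
    by move=> x Vx; rewrite deriveE//; exact: dpi.
  exact: (smooth_comp oV submersion_dom_open section_in_submersion_dom
    (smooth_derive w Cpi) sigma_smooth).
Qed.

(** The form [s^* eta_i] on a constant field; it is a primitive of the Kähler form
    by [base_J_form_pullback_eta]. *)
Definition pullback_eta i (w : 'rV[R]_d) (x : 'rV[R]_d) : R :=
  eta i b (sigma x) ('D_w sigma x).

Let sb x : V x -> cimg b (sigma x).
Proof. by move=> /section_domP[_ _ bx]; exact: coord_cimg. Qed.

Let eta_sigma_smooth i v : smooth V (fun x => eta i b (sigma x) v).
Proof.
exact: (smooth_comp1 oV sb (@of1_smooth _ _ _ (eta i) b v) sigma_smooth).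
Qed.

Let eta_sigma_linear i x : V x -> scalar (eta i b (sigma x)).
Proof. by move=> Vx; apply: of1_linear; exact: sb. Qed.

Lemma pullback_eta_smooth i w : smooth V (pullback_eta i w).
Proof.
exact: (smooth_scalar_family oV (L := fun x => eta i b (sigma x))
  (@eta_sigma_linear i) (eta_sigma_smooth i) (smooth_derive w sigma_smooth)).
Qed.

Lemma derive_pullback_eta i u w x : V x ->
  'D_u (pullback_eta i w) x =
  'D_('D_u sigma x) (fun z => eta i b z ('D_w sigma x)) (sigma x)
  + eta i b (sigma x) ('D_u ('D_w sigma) x).
Proof.
move=> Vx; have Cw := smooth_derive w sigma_smooth.
have [_ ->] := @derive_scalar_family _ _ _ _ _ _ oV Vx (smooth_diff Cw Vx)
  (fun x => eta i b (sigma x)) u (@eta_sigma_linear i)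
  (fun v => smooth_diff (eta_sigma_smooth i v) Vx).
congr (_ + _); apply: derive_comp; first exact: smooth_diff sigma_smooth Vx.
exact: smooth_diff (@of1_smooth _ _ _ (eta i) b _) (sb Vx).
Qed.

(** Exterior derivatives commute with pullbacks: the second derivatives of the
    section that appear in those of [pullback_eta] are symmetric and cancel. *)
Lemma base_J_form_pullback_eta i v w x : V x ->
  gN c x v (base_J i c b (param c x) w) =
  (2 * alpha)^-1 * ('D_v (pullback_eta i w) x - 'D_w (pullback_eta i v) x).
Proof.
move=> Vx; have [cx cp bp] := section_domP Vx.
have [_ xE] := cimg_param cx.
have ds u : dmap s c b (param c x) u = 'D_u sigma x.
  by rewrite /dmap xE deriveE//; exact: smooth_diff sigma_smooth Vx.
have a0 : 2 * alpha != 0.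
  by have [_ a0 _] := HM; rewrite mulf_neq0// pnatr_eq0.
have form := base_J_form cp bp i v w; rewrite (ds v) (ds w) xE in form.
have Tv := derive_pullback_eta i v w Vx; have Tw := derive_pullback_eta i w v Vx.
have C := smooth_derive_comm_row oV v w sigma_smooth Vx.
have Tv' := eq_trans Tv (congr1 (fun z => _ + eta i b (sigma x) z) C).
have aux (k t1 t2 e1 e2 q : R) : t1 = e1 + q -> t2 = e2 + q ->
    2 * alpha * k = e1 - e2 -> k = (2 * alpha)^-1 * (t1 - t2).
  by move=> -> -> E; rewrite opprD addrACA subrr addr0 -E mulKf.
exact: aux Tv' Tw form.
Qed.

(** Exact forms are closed. *)
Lemma base_J_form_closed i :
  closed_2form V (fun x v w => gN c x v (base_J i c b (param c x) w)).
Proof.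
move=> x u v w Vx.
have D a z z' : 'D_a (fun y => gN c y z (base_J i c b (param c y) z')) x =
    (2 * alpha)^-1 * ('D_a ('D_z (pullback_eta i z')) x - 'D_a ('D_z' (pullback_eta i z)) x).
  have E : \forall y \near x, ((2 * alpha)^-1 \*o
      ('D_z (pullback_eta i z') - 'D_z' (pullback_eta i z))) y =
      gN c y z (base_J i c b (param c y) z').
    by apply: (open_near oV Vx) => y Vy; rewrite base_J_form_pullback_eta.
  have dt l r : derivable ('D_l (pullback_eta i r)) x a.
    exact: diff_derivable (smooth_diff (smooth_derive l (pullback_eta_smooth i r)) Vx).
  rewrite -(near_eq_derive _ E) deriveMl; last exact: derivableB.
  by rewrite deriveB.
have aux (k a1 a2 a3 b1 b2 b3 : R) : a1 = b2 -> a2 = b3 -> a3 = b1 ->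
    k * (a1 - b1) + k * (a2 - b2) + k * (a3 - b3) = 0.
  by move=> -> -> ->; ring.
apply: eq_trans (congr2 +%R (congr2 +%R (D u v w) (D v w u)) (D w u v)) _.
exact: aux (smooth_derive_comm oV u v (pullback_eta_smooth i w) Vx)
  (smooth_derive_comm oV v w (pullback_eta_smooth i u) Vx)
  (smooth_derive_comm oV w u (pullback_eta_smooth i v) Vx).
Qed.
End LocalChart.

Definition chart_at (q : M) : atlas M := sval (cid (cdom_cover q)).

Lemma chart_atP q : cdom (chart_at q) q.
Proof. exact: svalP (cid (cdom_cover q)). Qed.

Definition base_structure i (c : atlas N) x v : 'rV[R]_d :=
  base_J i c (chart_at (s (param c x))) (param c x) v.

Lemma base_structureE i c b x v : section_dom c b x ->
  base_structure i c x v = base_J i c b (param c x) v.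
Proof.
by move=> /section_domP[cx cp bp]; apply: base_J_chart => //; exact: chart_atP.
Qed.

Lemma section_dom_chart_at c x : cimg c x ->
  section_dom c (chart_at (s (param c x))) x.
Proof.
move=> cx; have [cp xE] := cimg_param cx.
by exists (param c x) => //; split=> //; split=> //; exact: chart_atP.
Qed.

Lemma base_structure_linear i c x : cimg c x -> linear (base_structure i c x).
Proof.
by move=> /cimg_param[cp _]; apply: base_J_linear => //; exact: chart_atP.
Qed.

Lemma base_structure_smooth i c v :
  smooth (cimg c) (fun x => base_structure i c x v).
Proof.
move=> k; apply: Ck_local => x cx; set b := chart_at (s (param c x)).
exists (section_dom c b); split; first exact: section_dom_chart_at.
apply: (@eq_Ck _ _ _ _ _ (fun y => base_J i c b (param c y) v)).
- exact: section_dom_open.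
- by move=> y Vy; rewrite (base_structureE _ _ Vy).
- exact: base_J_smooth.
Qed.

Lemma base_structure_trans i c c' p v : cdom c p -> cdom c' p ->
  base_structure i c' (coord c' p) (dtrans c c' p v) =
  dtrans c c' p (base_structure i c (coord c p) v).
Proof.
move=> cp c'p; rewrite /base_structure !coordK//.
by apply: base_J_trans => //; exact: chart_atP.
Qed.

Definition base_endo_field i : endo_field N :=
  EndoField (base_structure_linear i) (base_structure_smooth i)
    (base_structure_trans i).

Theorem base_hyperkahler : hyperkahler gN.
Proof.
exists base_endo_field.
have Q c : for_even_perm (fun i j k => forall x v, cimg c x ->
    base_structure i c x (base_structure j c x v) = base_structure k c x v /\
    base_structure j c x (base_structure i c x v) = - base_structure k c x v).
  move=> t et x v /cimg_param[cp _].
  exact: (base_J_quaternion cp (chart_atP _) et v).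
split=> [i c|]; last by move=> t et c x v cx; exact: (Q c t et x v cx).
have oc : open (cimg c) by exact: cimg_open.
have ah j : almost_hermitian (cimg c) (gN c) (base_structure j c).
  split.
  - exact: base_structure_linear.
  - exact: base_structure_smooth.
  - by move=> x v /cimg_param[cp _]; exact: (base_J_sqr cp (chart_atP _)).
  - move=> x u v /cimg_param[cp xE].
    by have := base_J_isometry cp (chart_atP _) j u v; rewrite xE.
have closed j : closed_2form (cimg c) (kahler_form (gN c) (base_structure j c)).
  move=> x u v w cx; have Vx := section_dom_chart_at cx.
  set b := chart_at _ in Vx.
  have D a z z' :
      'D_a (fun y => kahler_form (gN c) (base_structure j c) y z z') x =
      'D_a (fun y => gN c y z (base_J j c b (param c y) z')) x.
    have oV : open (section_dom c b) by exact: section_dom_open.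
    have E : \forall y \near x, kahler_form (gN c) (base_structure j c) y z z' =
        gN c y z (base_J j c b (param c y) z').
      apply: (open_near oV Vx) => y Vy.
      by rewrite /kahler_form (base_structureE _ _ Vy).
    exact: near_eq_derive E.
  apply: eq_trans (congr2 +%R (congr2 +%R (D u v w) (D v w u)) (D w u v)) _.
  exact: base_J_form_closed Vx.
split; [exact: ah_sqr (ah i)|exact: ah_isometry (ah i)|].
exists (christoffel (gN c)); split.
  apply: levi_civita_christoffel => //.
  - by move=> x u; exact: rm_linear.
  - by move=> x u v; exact: rm_sym.
  - by move=> x v; exact: rm_pos.
  - by move=> u v; exact: rm_smooth.
apply: (closed_kahler_forms_parallel oc _ _ _ _ ah closed (Q c)).
- by move=> x u; exact: rm_linear.
- by move=> x u v; exact: rm_sym.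
- by move=> x v; exact: rm_pos.
- by move=> u v; exact: rm_smooth.
Qed.
End BaseStructure.

Theorem corollary2p2p1 (R : realType) (n : nat) (M : manifold R (4 * n + 3))
    (phi : 'I_3 -> endo_field M) (xi : 'I_3 -> vector_field M)
    (eta : 'I_3 -> one_form M) (g : riemannian_metric M) (alpha delta : R)
    (HM : sasaki_3_alpha_delta phi xi eta g alpha delta)
    (Hdegenerate : delta = 0)
    (d : nat) (N : manifold R d) (gN : riemannian_metric N)
    (U : set M) (f : M -> N) (Hf : canonical_submersion xi g gN U f)
    (s : N -> M) (Hs : smooth_section U f s) :
  hyperkahler gN.
Proof.
subst delta; exact: (base_hyperkahler HM Hf Hs).
Qed.
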